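(* Let $q$ be an $n$-ary quadratic form over $\mathbb{Z}$ and let $Q = x^2+yz+q$ be the quadratic form on $\mathbb{Z}^{n+3}$ given as the orthogonal direct sum of $x^2+yz$ (in new variables $x,y,z$) and $q$. Then there is an isomorphism of group schemes over $\operatorname{Spec}(\mathbb{Z})$ $$\operatorname{SL}_2(\operatorname{Clf}_q) \xrightarrow{\ \sim\ } \operatorname{Spin}_Q,$$ where $\operatorname{SL}_2(\operatorname{Clf}_q)$ is the functor $R \mapsto \operatorname{SL}_2(\operatorname{Clf}(q_R))$ and $\operatorname{Spin}_Q$ is the functor $R\mapsto \operatorname{Spin}(Q_R)$ on commutative rings $R$.
   Context: Quadratic forms: for a commutative ring $R$ and a free $R$-module $W$ of finite rank, a quadratic form is a map $q:W\to R$ with $q(tw)=t^2q(w)$ such that $(u,v)\mapsto q(u+v)-q(u)-q(v)$ is $R$-bilinear (it need not come from a bilinear form; $2$ need not be invertible). For $q$ over $\mathbb{Z}$, $q_R$ denotes its base change to $R$. Clifford algebra: $\operatorname{Clf}(W,q)=T(W)/I_q$, where $T(W)$ is the tensor algebra and $I_q$ the two-sided ideal generated by $v\otimes v+q(v)$, $v\in W$ (so $v^2=-q(v)$). $W$ is identified with its image. The Clifford vectors are $\operatorname{Vec}=R\cdot 1+W$. Involutions: the parity automorphism $x\mapsto x'$ (the algebra automorphism extending $v\mapsto -v$ on $W$), the transpose $x\mapsto x^*$ (the anti-automorphism induced by $v_1\otimes\cdots\otimes v_r\mapsto v_r\otimes\cdots\otimes v_1$), and Clifford conjugation $\bar x=(x')^*$.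 The even part $\operatorname{Clf}(W,q)_+$ is the span of products of an even number of elements of $W$. For $C=\operatorname{Clf}(W,q)$ over $R$, $\operatorname{GL}_2(C)$ is the set of matrices $\begin{pmatrix}a&b\\c&d\end{pmatrix}$ with entries in $C$ such that: (1) $ad^*-bc^*\in R^\times$; (2) $ab^*=ba^*$ and $cd^*=dc^*$; (3) $a\bar a,b\bar b,c\bar c,d\bar d\in R$; (4) $a\bar c,\ b\bar d\in\operatorname{Vec}(C)$; (5) for all $x\in\operatorname{Vec}(C)$, $ax\bar b+b\bar x\bar a\in R$ and $cx\bar d+d\bar x\bar c\in R$; (6) for all $x\in \operatorname{Vec}(C)$, $ax\bar d+b\bar x\bar c\in\operatorname{Vec}(C)$. $\operatorname{SL}_2(C)$ is the subset with pseudodeterminant $ad^*-bc^*=1$. The Clifford monoid is $\operatorname{Clf}(W,q)^{\mathrm{mon}}=\{x: x\bar x\in R,\ x\operatorname{Vec}x^*\subseteq\operatorname{Vec}\}$. The Spin group is $\operatorname{Spin}(W,q)=\{a\in \operatorname{Clf}(W,q)_+\cap\operatorname{Clf}(W,q)^{\mathrm{mon}}: aa^*=1,\ aWa^*\subseteq W\}$. *)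

(* Defs.v *)
From HB Require Import structures.
From mathcomp Require Import all_boot all_order all_algebra ring.
From mathcomp Require Import generic_quotient ring_quotient.
From mathcomp Require Import boolp classical_sets functions.

Set Implicit Arguments.
Unset Strict Implicit.
Unset Printing Implicit Defensive.

Import GRing.Theory.

Local Open Scope ring_scope.
Local Open Scope quotient_scope.

(* Commutative rings are [comPzRingType]s, so the zero ring is included; the  *)
(* free module of rank n is 'rV[R]_n, with its standard basis [delta_mx 0 i]. *)

Definition polar (R : comPzRingType) (n : nat) (q : 'rV[R]_n -> R)
  (u v : 'rV[R]_n) : R := q (u + v) - q u - q v.

Record qform (R : comPzRingType) (n : nat) := QForm {
  qform_fun :> 'rV[R]_n -> R;
  qformZ : forall (t : R) (w : 'rV[R]_n),
    qform_fun (t *: w) = t ^+ 2 * qform_fun w;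
  qform_polarl : forall v : 'rV[R]_n, scalar (polar qform_fun ^~ v);
  qform_polarr : forall u : 'rV[R]_n, scalar (polar qform_fun u)
}.

Lemma polarC (R : comPzRingType) n (q : 'rV[R]_n -> R) u v :
  polar q u v = polar q v u.
Proof. by rewrite /polar (addrC u) addrAC. Qed.

Section QformTheory.
Variables (R : comPzRingType) (n : nat) (q : qform R n).

Lemma qformD u v : q (u + v) = q u + q v + polar q u v.
Proof. by rewrite /polar; ring. Qed.

Lemma polarDl u v w : polar q (u + v) w = polar q u w + polar q v w.
Proof. by have := qform_polarl q w 1 u v; rewrite /= !scale1r => ->; ring. Qed.

Lemma polar0l w : polar q 0 w = 0.
Proof.
by have := polarDl 0 0 w; rewrite addr0 => /esym/eqP; rewrite -subr_eq0 addrK => /eqP.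
Qed.

Lemma polarZl a u w : polar q (a *: u) w = a * polar q u w.
Proof. by have := qform_polarl q w a u 0; rewrite /= addr0 polar0l addr0. Qed.

Lemma polar_sumr I (r : seq I) (F : I -> 'rV[R]_n) u :
  polar q u (\sum_(i <- r) F i) = \sum_(i <- r) polar q u (F i).
Proof.
rewrite polarC; elim: r => [|i r IHr]; first by rewrite !big_nil polar0l.
by rewrite !big_cons polarDl IHr polarC.
Qed.

Lemma qform0 : q 0 = 0.
Proof. by have := qformZ q 0 0; rewrite scale0r expr2 !mul0r. Qed.

End QformTheory.

Definition qcoef (R : comPzRingType) (n : nat) (q : qform R n)
    (i j : 'I_n) : R :=
  if i == j then q (delta_mx 0 i)
  else if (i < j)%N then polar q (delta_mx 0 i) (delta_mx 0 j) else 0.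

(* The base change of q along f, i.e. the quadratic form with the same        *)
(* coefficients q(e_i) and q(e_i + e_j) - q(e_i) - q(e_j) (i < j) as q; see   *)
(* [qform_bcE] for its compatibility with q.                                  *)
Definition qform_bc_fun (R S : comPzRingType) (n : nat) (f : {rmorphism R -> S})
    (q : qform R n) (w : 'rV[S]_n) : S :=
  \sum_i \sum_j f (qcoef q i j) * (w 0 i * w 0 j).

Section BaseChange.
Variables (R S : comPzRingType) (n : nat) (f : {rmorphism R -> S}).
Variable q : qform R n.

Lemma polar_bc u v : polar (qform_bc_fun f q) u v =
  \sum_i \sum_j f (qcoef q i j) * (u 0 i * v 0 j + v 0 i * u 0 j).
Proof.
rewrite /polar /qform_bc_fun -!sumrB; apply: eq_bigr => i _.
by rewrite -!sumrB; apply: eq_bigr => j _; rewrite !mxE; ring.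
Qed.

Fact qform_bcZ t w :
  qform_bc_fun f q (t *: w) = t ^+ 2 * qform_bc_fun f q w.
Proof.
rewrite /qform_bc_fun mulr_sumr; apply: eq_bigr => i _.
by rewrite mulr_sumr; apply: eq_bigr => j _; rewrite !mxE; ring.
Qed.

Fact qform_bc_polarr u : scalar (polar (qform_bc_fun f q) u).
Proof.
move=> a v w; rewrite !polar_bc mulr_sumr -big_split; apply: eq_bigr => i _.
by rewrite mulr_sumr -big_split; apply: eq_bigr => j _; rewrite /= !mxE; ring.
Qed.

Fact qform_bc_polarl v : scalar (polar (qform_bc_fun f q) ^~ v).
Proof. by move=> a u w; rewrite ![polar _ _ v]polarC qform_bc_polarr. Qed.

Definition qform_bc : qform S n :=
  QForm qform_bcZ qform_bc_polarl qform_bc_polarr.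

Lemma qform_bcE w : qform_bc (map_mx f w) = f (q w).
Proof.
suff qE : q w = \sum_i \sum_j qcoef q i j * (w 0 i * w 0 j).
  rewrite qE rmorph_sum; apply: eq_bigr => i _; rewrite rmorph_sum.
  by apply: eq_bigr => j _; rewrite !rmorphM !mxE.
have wE : w = \sum_(i <- enum 'I_n) w 0 i *: delta_mx 0 i.
  by rewrite big_enum {1}[w]row_sum_delta.
rewrite {1}wE -big_enum /=; under [RHS]eq_bigr do rewrite -big_enum /=.
have : sorted (fun i j : 'I_n => (i < j)%N) (enum 'I_n).
  by have := iota_ltn_sorted 0 n; rewrite -val_enum_ord sorted_map.
elim: (enum 'I_n) => [|k s IHs]; first by rewrite !big_nil qform0.
move=> ks; have tr : transitive (fun i j : 'I_n => (i < j)%N).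
  by move=> a b c; apply: ltn_trans.
have s_sorted := path_sorted ks.
have kP : {in s, forall j : 'I_n, (k < j)%N} by apply/allP; apply: order_path_min ks.
rewrite !big_cons qformD IHs // qformZ.
have -> : qcoef q k k = q (delta_mx 0 k) by rewrite /qcoef eqxx.
under [X in _ = _ + X]eq_bigr do rewrite big_cons.
rewrite big_split /= [X in _ = _ + (X + _)]big1_seq ?add0r; last first.
  move=> i /andP[_ /kP ki]; rewrite /qcoef -val_eqE /= gtn_eqF //.
  by rewrite ltnNge ltnW ?mul0r.
have -> : polar q (w 0 k *: delta_mx 0 k) (\sum_(j <- s) w 0 j *: delta_mx 0 j)
    = \sum_(j <- s) qcoef q k j * (w 0 k * w 0 j).
  rewrite polar_sumr !big_seq; apply: eq_bigr => j /kP kj.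
  rewrite polarZl polarC polarZl polarC /qcoef -val_eqE /= ltn_eqF // kj; ring.
ring.
Qed.

End BaseChange.

Section OrthogonalSum.
Variables (R : comPzRingType) (m n : nat) (p : qform R m) (q : qform R n).

Definition qform_sum_fun (w : 'rV[R]_(m + n)) : R := p (lsubmx w) + q (rsubmx w).

Fact qform_sumZ t w : qform_sum_fun (t *: w) = t ^+ 2 * qform_sum_fun w.
Proof. by rewrite /qform_sum_fun !linearZ /= !qformZ mulrDr. Qed.

Fact qform_sum_polarr u : scalar (polar qform_sum_fun u).
Proof.
have E v : polar qform_sum_fun u v =
    polar p (lsubmx u) (lsubmx v) + polar q (rsubmx u) (rsubmx v).
  by rewrite /polar /qform_sum_fun !linearD; ring.
by move=> a v w; rewrite !E !linearP /= !qform_polarr; ring.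
Qed.

Fact qform_sum_polarl v : scalar (polar qform_sum_fun ^~ v).
Proof. by move=> a u w; rewrite ![polar _ _ v]polarC qform_sum_polarr. Qed.

Definition qform_sum : qform R (m + n) :=
  QForm qform_sumZ qform_sum_polarl qform_sum_polarr.

End OrthogonalSum.

Section TernaryForm.
Variable R : comPzRingType.

(* x^2 + yz, with (x, y, z) = (w 0 0, w 0 1, w 0 2)                           *)
Definition qform_xyz_fun (w : 'rV[R]_3) : R := w 0 0 ^+ 2 + w 0 1 * w 0 2.

Fact qform_xyzZ t w : qform_xyz_fun (t *: w) = t ^+ 2 * qform_xyz_fun w.
Proof. by rewrite /qform_xyz_fun !mxE; ring. Qed.

Fact qform_xyz_polarr u : scalar (polar qform_xyz_fun u).
Proof. by move=> a v w; rewrite /polar /qform_xyz_fun !mxE /=; ring. Qed.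

Fact qform_xyz_polarl v : scalar (polar qform_xyz_fun ^~ v).
Proof. by move=> a u w; rewrite ![polar _ _ v]polarC qform_xyz_polarr. Qed.

Definition qform_xyz : qform R 3 :=
  QForm qform_xyzZ qform_xyz_polarl qform_xyz_polarr.

End TernaryForm.

(* T(R^n), the direct sum over k of the free modules (R^n)^{\otimes k}, with  *)
(* the basis e_{i_1} \otimes ... \otimes e_{i_k} indexed by the words         *)
(* [:: i_1; ...; i_k] in 'I_n: an element is the family of its coordinates,   *)
(* and it is nonzero in finitely many degrees only.                           *)
Record tensor (R : comPzRingType) (n : nat) := Tensor {
  tcoef :> seq 'I_n -> R;
  tensorP : exists N : nat, forall w, (N <= size w)%N -> tcoef w = 0
}.

HB.instance Definition _ (R : comPzRingType) n := gen_eqMixin (tensor R n).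
HB.instance Definition _ (R : comPzRingType) n := gen_choiceMixin (tensor R n).

Lemma tensor_inj (R : comPzRingType) n (s t : tensor R n) : s =1 t -> s = t.
Proof.
case: s t => [s sP] [t tP] /= /funext st; case: _ / st tP => tP.
by congr Tensor; apply: Prop_irrelevance.
Qed.

Section TensorRing.
Variables (R : comPzRingType) (n : nat).
Implicit Types (s t : tensor R n) (w : seq 'I_n).

Fact tzero_subproof : exists N : nat, forall w, (N <= size w)%N -> 0 = 0 :> R.
Proof. by exists 0%N. Qed.
Definition tzero : tensor R n := @Tensor R n (fun=> 0) tzero_subproof.

Fact topp_subproof s :
  exists N : nat, forall w, (N <= size w)%N -> - s w = 0.
Proof. by have [N sN] := tensorP s; exists N => w /sN ->; rewrite oppr0. Qed.
Definition topp s : tensor R n := Tensor (topp_subproof s).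

Fact tadd_subproof s t :
  exists N : nat, forall w, (N <= size w)%N -> s w + t w = 0.
Proof.
have [[M sM] [N tN]] := (tensorP s, tensorP t); exists (maxn M N) => w.
by rewrite geq_max => /andP[/sM-> /tN->]; rewrite addr0.
Qed.
Definition tadd s t : tensor R n := Tensor (tadd_subproof s t).

Fact tscale_subproof (a : R) s :
  exists N : nat, forall w, (N <= size w)%N -> a * s w = 0.
Proof. by have [N sN] := tensorP s; exists N => w /sN ->; rewrite mulr0. Qed.
Definition tscale (a : R) s : tensor R n := Tensor (tscale_subproof a s).

Fact tone_subproof :
  exists N : nat, forall w, (N <= size w)%N -> (w == [::])%:R = 0 :> R.
Proof. by exists 1%N => -[]. Qed.
Definition tone : tensor R n := Tensor tone_subproof.

(* The multiplication is the concatenation of words on the basis.             *)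
Definition tmul_fun (s t : seq 'I_n -> R) w : R :=
  \sum_(i < (size w).+1) s (take i w) * t (drop i w).

Fact tmul_subproof s t :
  exists N : nat, forall w, (N <= size w)%N -> tmul_fun s t w = 0.
Proof.
have [[M sM] [N tN]] := (tensorP s, tensorP t); exists (M + N)%N => w wMN.
apply: big1 => i _; have iw : (i <= size w)%N by rewrite -ltnS.
have [Mi|iM] := leqP M i; first by rewrite sM ?mul0r // size_takel.
rewrite tN ?mulr0 // size_drop leq_subRL //.
by apply: leq_trans wMN; rewrite leq_add2r ltnW.
Qed.
Definition tmul s t : tensor R n := Tensor (tmul_subproof s t).

Lemma tmul_nil (s t : seq 'I_n -> R) : tmul_fun s t [::] = s [::] * t [::].
Proof. by rewrite /tmul_fun big_ord1. Qed.

Lemma tmul_cons (s t : seq 'I_n -> R) a w : tmul_fun s t (a :: w) =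
  s [::] * t (a :: w) + tmul_fun (fun v => s (a :: v)) t w.
Proof. by rewrite /tmul_fun big_ord_recl. Qed.

Lemma tmul_funDl (s s' t : seq 'I_n -> R) w :
  tmul_fun (fun v => s v + s' v) t w = tmul_fun s t w + tmul_fun s' t w.
Proof. by rewrite -big_split; apply: eq_bigr => i _; rewrite mulrDl. Qed.

Lemma tmul_funDr (s t t' : seq 'I_n -> R) w :
  tmul_fun s (fun v => t v + t' v) w = tmul_fun s t w + tmul_fun s t' w.
Proof. by rewrite -big_split; apply: eq_bigr => i _; rewrite mulrDr. Qed.

Lemma tmul_funZl a (s t : seq 'I_n -> R) w :
  tmul_fun (fun v => a * s v) t w = a * tmul_fun s t w.
Proof. by rewrite mulr_sumr; apply: eq_bigr => i _; rewrite mulrA. Qed.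

Lemma tmul_funA (s t u : seq 'I_n -> R) w :
  tmul_fun s (tmul_fun t u) w = tmul_fun (tmul_fun s t) u w.
Proof.
elim: w s t => [|a w IHw] s t; first by rewrite !tmul_nil mulrA.
rewrite tmul_cons IHw [RHS]tmul_cons tmul_nil tmul_cons mulrDr mulrA -addrA.
congr (_ + _); rewrite -tmul_funZl -tmul_funDl.
by apply: eq_bigr => i _; rewrite tmul_cons.
Qed.

Fact taddA : associative tadd.
Proof. by move=> s t u; apply: tensor_inj => w /=; rewrite addrA. Qed.
Fact taddC : commutative tadd.
Proof. by move=> s t; apply: tensor_inj => w /=; rewrite addrC. Qed.
Fact tadd0 : left_id tzero tadd.
Proof. by move=> s; apply: tensor_inj => w /=; rewrite add0r. Qed.
Fact taddN : left_inverse tzero topp tadd.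
Proof. by move=> s; apply: tensor_inj => w /=; rewrite addNr. Qed.

HB.instance Definition _ :=
  GRing.isZmodule.Build (tensor R n) taddA taddC tadd0 taddN.

Fact tmulA : associative tmul.
Proof. by move=> s t u; apply: tensor_inj => w; apply: tmul_funA. Qed.
Fact tmul1l : left_id tone tmul.
Proof.
move=> s; apply: tensor_inj => -[|a w] /=; first by rewrite tmul_nil mul1r.
rewrite tmul_cons mul1r /tmul_fun big1 ?addr0 // => i _.
by rewrite mul0r.
Qed.
Fact tmul1r : right_id tone tmul.
Proof.
move=> s; apply: tensor_inj => w /=; rewrite /tmul_fun big_ord_recr /=.
rewrite take_size drop_size mulr1 big1 ?add0r // => i _.
by rewrite -size_eq0 size_drop subn_eq0 leqNgt ltn_ord mulr0.
Qed.
Fact tmulDl : left_distributive tmul tadd.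
Proof. by move=> s t u; apply: tensor_inj => w; apply: tmul_funDl. Qed.
Fact tmulDr : right_distributive tmul tadd.
Proof. by move=> s t u; apply: tensor_inj => w; apply: tmul_funDr. Qed.

HB.instance Definition _ :=
  GRing.Zmodule_isPzRing.Build (tensor R n) tmulA tmul1l tmul1r tmulDl tmulDr.

Fact tscaleA a b s : tscale a (tscale b s) = tscale (a * b) s.
Proof. by apply: tensor_inj => w /=; rewrite mulrA. Qed.
Fact tscale1 : left_id 1 tscale.
Proof. by move=> s; apply: tensor_inj => w /=; rewrite mul1r. Qed.
Fact tscaleDr : right_distributive tscale +%R.
Proof. by move=> a s t; apply: tensor_inj => w /=; rewrite mulrDr. Qed.
Fact tscaleDl s : {morph tscale^~ s : a b / a + b}.
Proof. by move=> a b; apply: tensor_inj => w /=; rewrite mulrDl. Qed.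

HB.instance Definition _ := GRing.Zmodule_isLmodule.Build R (tensor R n)
  tscaleA tscale1 tscaleDr tscaleDl.

Lemma tscaleAl a s t : a *: (s * t) = (a *: s) * t.
Proof. by apply: tensor_inj => w; rewrite /= -tmul_funZl. Qed.
Lemma tscaleAr a s t : a *: (s * t) = s * (a *: t).
Proof.
apply: tensor_inj => w; rewrite /= /tmul_fun mulr_sumr.
by apply: eq_bigr => i _; rewrite mulrCA.
Qed.

Definition tvec_fun (v : 'rV[R]_n) w : R := if w is [:: i] then v 0 i else 0.
Fact tvec_subproof (v : 'rV[R]_n) :
  exists N : nat, forall w, (N <= size w)%N -> tvec_fun v w = 0.
Proof. by exists 2%N => -[|? []]. Qed.
Definition tvec (v : 'rV[R]_n) : tensor R n := Tensor (tvec_subproof v).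

Fact tpar_subproof s :
  exists N : nat, forall w, (N <= size w)%N -> (-1) ^+ size w * s w = 0.
Proof. by have [N sN] := tensorP s; exists N => w /sN ->; rewrite mulr0. Qed.
Definition tpar s : tensor R n := Tensor (tpar_subproof s).

Fact trev_subproof s :
  exists N : nat, forall w, (N <= size w)%N -> s (rev w) = 0.
Proof. by have [N sN] := tensorP s; exists N => w; rewrite -size_rev => /sN. Qed.
Definition trev s : tensor R n := Tensor (trev_subproof s).

Lemma tparD : {morph tpar : s t / s + t}.
Proof. by move=> s t; apply: tensor_inj => w /=; rewrite mulrDr. Qed.
Lemma tparN : {morph tpar : s / - s}.
Proof. by move=> s; apply: tensor_inj => w /=; rewrite mulrN. Qed.
Lemma tparZ a : {morph tpar : s / a *: s}.
Proof. by move=> s; apply: tensor_inj => w /=; rewrite mulrCA. Qed.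
Lemma tpar1 : tpar 1 = 1.
Proof. by apply: tensor_inj => -[|a w] /=; rewrite ?mulr0 // mulr1. Qed.
Lemma tparM : {morph tpar : s t / s * t}.
Proof.
move=> s t; apply: tensor_inj => w; rewrite /= /tmul_fun mulr_sumr.
apply: eq_bigr => i _; rewrite mulrACA -exprD size_take_min size_drop.
by have /minn_idPl -> : (i <= size w)%N; rewrite ?subnKC // -ltnS.
Qed.
Lemma tpar_vec v : tpar (tvec v) = - tvec v.
Proof.
by apply: tensor_inj => -[|i []] /= *; rewrite ?mulr0 ?oppr0 // expr1 mulN1r.
Qed.

Lemma trevD : {morph trev : s t / s + t}.
Proof. by move=> s t; apply: tensor_inj. Qed.
Lemma trevN : {morph trev : s / - s}.
Proof. by move=> s; apply: tensor_inj. Qed.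
Lemma trevZ a : {morph trev : s / a *: s}.
Proof. by move=> s; apply: tensor_inj. Qed.
Lemma trev1 : trev 1 = 1.
Proof. by apply: tensor_inj => w /=; rewrite -!size_eq0 size_rev. Qed.
Lemma trevM s t : trev (s * t) = trev t * trev s.
Proof.
apply: tensor_inj => w; rewrite /= /tmul_fun size_rev.
rewrite (reindex_inj rev_ord_inj) /=; apply: eq_bigr => i _.
by rewrite subSS take_rev drop_rev mulrC subKn // -ltnS.
Qed.
Lemma trev_vec v : trev (tvec v) = tvec v.
Proof.
apply: tensor_inj => -[|i []] //= j w.
by have := size_rev [:: i, j & w]; case: (rev [:: i, j & w]) => [|? []].
Qed.

End TensorRing.

Section TensorBaseChange.
Variables (R S : comPzRingType) (n : nat) (f : {rmorphism R -> S}).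

Fact tmap_subproof (s : tensor R n) :
  exists N : nat, forall w, (N <= size w)%N -> f (s w) = 0.
Proof. by have [N sN] := tensorP s; exists N => w /sN ->; rewrite rmorph0. Qed.
Definition tmap (s : tensor R n) : tensor S n := Tensor (tmap_subproof s).

Lemma tmapD : {morph tmap : s t / s + t}.
Proof. by move=> s t; apply: tensor_inj => w /=; rewrite rmorphD. Qed.
Lemma tmapN : {morph tmap : s / - s}.
Proof. by move=> s; apply: tensor_inj => w /=; rewrite rmorphN. Qed.
Lemma tmapZ a s : tmap (a *: s) = f a *: tmap s.
Proof. by apply: tensor_inj => w /=; rewrite rmorphM. Qed.
Lemma tmap1 : tmap 1 = 1.
Proof. by apply: tensor_inj => w /=; rewrite rmorph_nat. Qed.
Lemma tmapM : {morph tmap : s t / s * t}.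
Proof.
move=> s t; apply: tensor_inj => w; rewrite /= /tmul_fun rmorph_sum.
by apply: eq_bigr => i _; rewrite rmorphM.
Qed.
Lemma tmap_vec v : tmap (tvec v) = tvec (map_mx f v).
Proof. by apply: tensor_inj => -[|i []] //=; rewrite ?rmorph0 // mxE. Qed.

End TensorBaseChange.

Section Clifford.
Variables (R : comPzRingType) (n : nat) (q : qform R n).

Inductive clf_ideal : tensor R n -> Prop :=
| clf_ideal_gen v : clf_ideal (tvec v * tvec v + q v *: (1 : tensor R n))
| clf_ideal0 : clf_ideal 0
| clf_idealD s t : clf_ideal s -> clf_ideal t -> clf_ideal (s + t)
| clf_idealMl s t : clf_ideal t -> clf_ideal (s * t)
| clf_idealMr s t : clf_ideal s -> clf_ideal (s * t).

Definition clf_ideal_pred : {pred tensor R n} := fun s => `[< clf_ideal s >].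

Fact clf_ideal_zmod_closed : zmod_closed clf_ideal_pred.
Proof.
split=> [|s t /asboolP Is /asboolP It]; apply/asboolP; first exact: clf_ideal0.
by rewrite -mulN1r; apply: clf_idealD => //; apply: clf_idealMl.
Qed.
HB.instance Definition _ :=
  GRing.isZmodClosed.Build (tensor R n) clf_ideal_pred clf_ideal_zmod_closed.

Definition Clf : Type := Quotient.quot clf_ideal_pred.

HB.instance Definition _ := Choice.on Clf.
HB.instance Definition _ := GRing.Zmodule.on Clf.
HB.instance Definition _ := Quotient.on Clf.

Definition clf_pi (s : tensor R n) : Clf := \pi_Clf s.

Local Notation pi := clf_pi.

Lemma clf_piP x : exists s, x = pi s.
Proof. by exists (repr x); rewrite /clf_pi reprK. Qed.

Lemma clf_eqP (s t : tensor R n) : pi s = pi t <-> clf_ideal (s - t).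
Proof.
rewrite /clf_pi; split=> [/eqP|Ist]; last apply/eqP; rewrite -Quotient.idealrBE.
  by move/asboolP.
exact/asboolP.
Qed.

Lemma clf_piD s t : pi (s + t) = pi s + pi t.
Proof. by rewrite /clf_pi piE. Qed.
Lemma clf_piN s : pi (- s) = - pi s.
Proof. by rewrite /clf_pi piE. Qed.
Lemma clf_pi0 : pi 0 = 0.
Proof. by rewrite /clf_pi piE. Qed.

Lemma clf_ideal_repr s : clf_ideal (s - repr (pi s)).
Proof. by apply/clf_eqP; rewrite /clf_pi reprK. Qed.

Lemma clf_ideal_reprN s : clf_ideal (repr (pi s) - s).
Proof. by apply/clf_eqP; rewrite /clf_pi reprK. Qed.

Definition clf_one : Clf := pi 1.
Definition clf_mul (x y : Clf) : Clf := pi (repr x * repr y).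
Definition clf_scale (a : R) (x : Clf) : Clf := pi (a *: repr x).

Fact clf_pi_mul s t : pi (s * t) = clf_mul (pi s) (pi t).
Proof.
apply/clf_eqP; rewrite -(subrK (s * repr (pi t)) (s * t)) -mulrBr.
rewrite -addrA -mulrBl; apply: clf_idealD; first exact/clf_idealMl/clf_ideal_repr.
exact/clf_idealMr/clf_ideal_repr.
Qed.

Fact clf_pi_scale a s : pi (a *: s) = clf_scale a (pi s).
Proof.
apply/clf_eqP; rewrite -scalerBr -[s - _]mul1r tscaleAl.
exact/clf_idealMl/clf_ideal_repr.
Qed.

Fact clf_mulA : associative clf_mul.
Proof.
move=> x y z; have [[[s ->] [t ->]] [u ->]] := (clf_piP x, clf_piP y, clf_piP z).
by rewrite -!clf_pi_mul mulrA.
Qed.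
Fact clf_mul1l : left_id clf_one clf_mul.
Proof. by move=> x; have [s ->] := clf_piP x; rewrite -clf_pi_mul mul1r. Qed.
Fact clf_mul1r : right_id clf_one clf_mul.
Proof. by move=> x; have [s ->] := clf_piP x; rewrite -clf_pi_mul mulr1. Qed.
Fact clf_mulDl : left_distributive clf_mul +%R.
Proof.
move=> x y z; have [[[s ->] [t ->]] [u ->]] := (clf_piP x, clf_piP y, clf_piP z).
rewrite -clf_piD -!clf_pi_mul.
by rewrite -clf_piD mulrDl.
Qed.
Fact clf_mulDr : right_distributive clf_mul +%R.
Proof.
move=> x y z; have [[[s ->] [t ->]] [u ->]] := (clf_piP x, clf_piP y, clf_piP z).
rewrite -clf_piD -!clf_pi_mul.
by rewrite -clf_piD mulrDr.
Qed.

HB.instance Definition _ := GRing.Zmodule_isPzRing.Build Clf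
  clf_mulA clf_mul1l clf_mul1r clf_mulDl clf_mulDr.

Fact clf_scaleA a b x : clf_scale a (clf_scale b x) = clf_scale (a * b) x.
Proof. by have [s ->] := clf_piP x; rewrite -!clf_pi_scale scalerA. Qed.
Fact clf_scale1 : left_id 1 clf_scale.
Proof. by move=> x; have [s ->] := clf_piP x; rewrite -clf_pi_scale scale1r. Qed.
Fact clf_scaleDr : right_distributive clf_scale +%R.
Proof.
move=> a x y; have [[s ->] [t ->]] := (clf_piP x, clf_piP y).
rewrite -clf_piD -!clf_pi_scale.
by rewrite scalerDr clf_piD.
Qed.
Fact clf_scaleDl x : {morph clf_scale^~ x : a b / a + b}.
Proof.
move=> a b; have [s ->] := clf_piP x.
by rewrite /= -!clf_pi_scale scalerDl clf_piD.
Qed.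

HB.instance Definition _ := GRing.Zmodule_isLmodule.Build R Clf
  clf_scaleA clf_scale1 clf_scaleDr clf_scaleDl.

Lemma clf_piM s t : pi (s * t) = pi s * pi t.
Proof. exact: clf_pi_mul. Qed.
Lemma clf_piZ a s : pi (a *: s) = a *: pi s.
Proof. exact: clf_pi_scale. Qed.
Lemma clf_pi1 : pi 1 = 1.
Proof. by []. Qed.

Definition clf_scal (r : R) : Clf := r *: (1 : Clf).

Definition clf_vec (v : 'rV[R]_n) : Clf := pi (tvec v).

Lemma clf_vec_sqr v : clf_vec v * clf_vec v = - clf_scal (q v).
Proof.
rewrite /clf_scal -clf_piM -clf_pi1 -clf_piZ -clf_piN; apply/clf_eqP; rewrite opprK.
exact: clf_ideal_gen.
Qed.

Definition clf_par (x : Clf) : Clf := pi (tpar (repr x)).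
Definition clf_rev (x : Clf) : Clf := pi (trev (repr x)).
Definition clf_conj (x : Clf) : Clf := clf_rev (clf_par x).

Lemma clf_par_pi s : clf_par (pi s) = pi (tpar s).
Proof.
apply/clf_eqP; rewrite -tparN -tparD.
elim: (clf_ideal_reprN s) => {s} [v||s t _ Is _ It|s t _ It|s t _ Is].
- by rewrite tparD tparM tparZ tpar1 tpar_vec mulrNN; apply: clf_ideal_gen.
- by rewrite -[0](addNr 0) tparD tparN addNr; apply: clf_ideal0.
- by rewrite tparD; apply: clf_idealD.
- by rewrite tparM; apply: clf_idealMl.
- by rewrite tparM; apply: clf_idealMr.
Qed.

Lemma clf_rev_pi s : clf_rev (pi s) = pi (trev s).
Proof.
apply/clf_eqP; rewrite -trevN -trevD.
elim: (clf_ideal_reprN s) => {s} [v||s t _ Is _ It|s t _ It|s t _ Is].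
- by rewrite trevD trevM trevZ trev1 trev_vec; apply: clf_ideal_gen.
- by rewrite -[0](addNr 0) trevD trevN addNr; apply: clf_ideal0.
- by rewrite trevD; apply: clf_idealD.
- by rewrite trevM; apply: clf_idealMr.
- by rewrite trevM; apply: clf_idealMl.
Qed.

Local Notation "x ^*" := (clf_rev x) : ring_scope.

Definition is_scalar (x : Clf) : Prop := exists r : R, x = clf_scal r.

(* Membership in the image of R^\times: [comPzRingType] has no unit predicate. *)
Definition is_unit_scalar (x : Clf) : Prop :=
  exists r s : R, r * s = 1 /\ x = clf_scal r.

Definition is_vector (x : Clf) : Prop := exists v : 'rV[R]_n, x = clf_vec v.

Definition is_clfvec (x : Clf) : Prop :=
  exists (r : R) (v : 'rV[R]_n), x = clf_scal r + clf_vec v.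

Definition is_even (x : Clf) : Prop :=
  exists s : seq (R * seq 'rV[R]_n),
    all (fun p => ~~ odd (size p.2)) s /\
    x = \sum_(p <- s) p.1 *: \prod_(v <- p.2) clf_vec v.

Definition clf_monoid (x : Clf) : Prop :=
  is_scalar (x * clf_conj x) /\
  forall y, is_clfvec y -> is_clfvec (x * y * x^*).

Definition pdet (M : 'M[Clf]_2) : Clf := M 0 0 * (M 1 1)^* - M 0 1 * (M 1 0)^*.

Definition GL2 (M : 'M[Clf]_2) : Prop :=
  let: a := M 0 0 in let: b := M 0 1 in let: c := M 1 0 in let: d := M 1 1 in
  [/\ is_unit_scalar (pdet M),
      a * b^* = b * a^* /\ c * d^* = d * c^*,
      [/\ is_scalar (a * clf_conj a), is_scalar (b * clf_conj b),
          is_scalar (c * clf_conj c) & is_scalar (d * clf_conj d)],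
      is_clfvec (a * clf_conj c) /\ is_clfvec (b * clf_conj d) &
      forall x, is_clfvec x ->
        [/\ is_scalar (a * x * clf_conj b + b * clf_conj x * clf_conj a),
            is_scalar (c * x * clf_conj d + d * clf_conj x * clf_conj c) &
            is_clfvec (a * x * clf_conj d + b * clf_conj x * clf_conj c)]].

Definition SL2 (M : 'M[Clf]_2) : Prop := GL2 M /\ pdet M = 1.

Definition Spin (a : Clf) : Prop :=
  [/\ is_even a, clf_monoid a, a * a^* = 1 &
      forall x, is_vector x -> is_vector (a * x * a^*)].

End Clifford.

Section CliffordBaseChange.
Variables (R S : comPzRingType) (n : nat) (f : {rmorphism R -> S}).
Variables (p : qform R n) (q : qform S n).

(* The ring morphism Clf(p) -> Clf(q) induced by f when q is the base change  *)
(* of p along f.                                                              *)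
Definition clf_map (x : Clf p) : Clf q := clf_pi q (tmap f (repr x)).

Lemma clf_map_pi (s : tensor R n) :
  (forall v, q (map_mx f v) = f (p v)) ->
  clf_map (clf_pi p s) = clf_pi q (tmap f s).
Proof.
move=> pq; apply/clf_eqP; rewrite -tmapN -tmapD.
elim: (clf_ideal_reprN p s) => {s} [v||s t _ Is _ It|s t _ It|s t _ Is].
- by rewrite tmapD tmapM tmapZ tmap1 tmap_vec -pq; apply: clf_ideal_gen.
- by rewrite -[0](addNr 0) tmapD tmapN addNr; apply: clf_ideal0.
- by rewrite tmapD; apply: clf_idealD.
- by rewrite tmapM; apply: clf_idealMl.
- by rewrite tmapM; apply: clf_idealMr.
Qed.

End CliffordBaseChange.

(* A functor R |-> G(R) from commutative rings to sets, with G(R) given as a  *)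
(* subset of (the underlying set of) a ring depending functorially on R.      *)
Record subfunctor := Subfunctor {
  ambient : comPzRingType -> pzRingType;
  ambient_map : forall R S : comPzRingType,
    {rmorphism R -> S} -> ambient R -> ambient S;
  points : forall R : comPzRingType, set (ambient R)
}.

Arguments ambient_map s {R S} _ _.
Arguments points s R : clear implicits.

Definition is_mul_group (A : pzRingType) (G : set A) : Prop :=
  [/\ G 1, forall x y, G x -> G y -> G (x * y) &
      forall x, G x -> exists y, [/\ G y, x * y = 1 & y * x = 1]].

(* R |-> points R is a functor to groups, for the multiplication of the       *)
(* ambient ring.                                                              *)
Definition is_group_functor (G : subfunctor) : Prop :=
  [/\ forall R, is_mul_group (points G R),
      forall (R S : comPzRingType) (f : {rmorphism R -> S}) x,
        points G R x -> points G S (ambient_map G f x),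
      forall (R S : comPzRingType) (f : {rmorphism R -> S}) x y,
        points G R x -> points G R y ->
        ambient_map G f (x * y) = ambient_map G f x * ambient_map G f y,
      forall (R : comPzRingType) x,
        points G R x -> ambient_map G idfun x = x &
      forall (R S T : comPzRingType) (f : {rmorphism R -> S})
             (g : {rmorphism S -> T}) x,
        points G R x ->
        ambient_map G (g \o f) x = ambient_map G g (ambient_map G f x)].

(* Isomorphism of group functors: group isomorphisms G(R) -> H(R) natural in  *)
(* R. The values of phi outside points R are irrelevant.                      *)
Definition group_functor_iso (G H : subfunctor)
    (phi : forall R, ambient G R -> ambient H R) : Prop :=
  [/\ forall R, set_bij (points G R) (points H R) (phi R),
      forall R (x y : ambient G R), points G R x -> points G R y ->
        phi R (x * y) = phi R x * phi R y &
      forall (R S : comPzRingType) (f : {rmorphism R -> S}) x, points G R x ->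
        phi S (ambient_map G f x) = ambient_map H f (phi R x)].

Section Schemes.
Variables (n : nat) (q : qform int n).

Definition qform_over (R : comPzRingType) : qform R n :=
  qform_bc (intmul 1 : {rmorphism int -> R}) q.

Definition clf_over_map (R S : comPzRingType) (f : {rmorphism R -> S}) :
    Clf (qform_over R) -> Clf (qform_over S) :=
  clf_map f (qform_over S).

Lemma qform_over_map (R S : comPzRingType) (f : {rmorphism R -> S}) v :
  qform_over S (map_mx f v) = f (qform_over R v).
Proof.
rewrite /= /qform_bc_fun rmorph_sum; apply: eq_bigr => i _.
rewrite rmorph_sum; apply: eq_bigr => j _.
by rewrite rmorphM !mxE /= rmorphM rmorph_int.
Qed.

Lemma clf_over_map_pi (R S : comPzRingType) (f : {rmorphism R -> S}) s :
  clf_over_map f (clf_pi (qform_over R) s) = clf_pi (qform_over S) (tmap f s).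
Proof. exact/clf_map_pi/qform_over_map. Qed.

Definition SL2_scheme : subfunctor := {|
  ambient R := 'M[Clf (qform_over R)]_2;
  ambient_map R S f := map_mx (clf_over_map f);
  points R := @SL2 R n (qform_over R)
|}.

Definition Spin_scheme : subfunctor := {|
  ambient R := Clf (qform_over R);
  ambient_map R S f := clf_over_map f;
  points R := @Spin R n (qform_over R)
|}.

End Schemes.

(* Main.v *)
(** Let e, f, g be the basis of the form x^2 + yz inside Clf(Q), so e^2 = -1,
    f^2 = g^2 = 0 and fg + gf = -1.  The elements ef and -eg are matrix units
    E_12 and E_21.  The odd element omega = e (gf - fg) has square -1, commutes
    with e, f, g and anticommutes with the vectors of q, so w |-> omega w
    extends to a morphism from Clf(q) to the centralizer of the matrix units.
    This gives an isomorphism psi from M_2(Clf(q)) onto the even part of Clf(Q).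
    Under psi the transpose becomes adj M = [[d^*, -b^*], [-c^*, a^*]], and the
    vectors (x, y, z, w) of Q, multiplied by omega on the right, become the
    matrices X = [[xi, y], [z, -conj xi]] with xi = - x - w.  The entries of
    M X (adj M)' are exactly the expressions in the conditions defining
    GL_2(Clf(q)), so Spin(Q) corresponds to SL_2(Clf(q)).

    Closure under inverses is not visible from the definitions.  As Clf(Q) is a
    finitely generated R-module, Cayley-Hamilton makes every endomorphism
    integral; hence a right inverse of an endomorphism h is a polynomial in h.
    Applied to left multiplication, this makes a^* a two-sided inverse of a;
    applied to conjugation by a, it shows that a^* also preserves the vectors. *)

Require Import Defs.
From HB Require Import structures.
From mathcomp Require Import all_boot all_order all_algebra ring.
From mathcomp Require Import boolp classical_sets functions.

Set Implicit Arguments.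
Unset Strict Implicit.
Unset Printing Implicit Defensive.

Import GRing.Theory.

Local Open Scope ring_scope.

(** * Clifford algebras and their universal property *)

Section CliffordTheory.
Variables (R : comPzRingType) (n : nat) (q : qform R n).
Implicit Types (x y z : Clf q) (r : R) (v : 'rV[R]_n) (s t : tensor R n).

Lemma clf_scaleAl r x y : r *: (x * y) = (r *: x) * y.
Proof.
have [[s ->] [t ->]] := (clf_piP x, clf_piP y).
by rewrite -clf_piM -!clf_piZ -clf_piM tscaleAl.
Qed.

Lemma clf_scaleAr r x y : r *: (x * y) = x * (r *: y).
Proof.
have [[s ->] [t ->]] := (clf_piP x, clf_piP y).
by rewrite -clf_piM -!clf_piZ -clf_piM tscaleAr.
Qed.

Lemma clf_scalE r x : clf_scal q r * x = r *: x.
Proof. by rewrite -clf_scaleAl mul1r. Qed.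

Lemma clf_scalC r x : clf_scal q r * x = x * clf_scal q r.
Proof. by rewrite clf_scalE -clf_scaleAr mulr1. Qed.

Lemma clf_scal1 : clf_scal q 1 = 1. Proof. exact: scale1r. Qed.
Lemma clf_scal0 : clf_scal q 0 = 0. Proof. exact: scale0r. Qed.

Lemma clf_scalD : {morph clf_scal q : r s / r + s}.
Proof. by move=> r s; rewrite /clf_scal scalerDl. Qed.

Lemma clf_scalN : {morph clf_scal q : r / - r}.
Proof. by move=> r; rewrite /clf_scal scaleNr. Qed.

Lemma clf_scalM : {morph clf_scal q : r s / r * s}.
Proof. by move=> r s; rewrite clf_scalE /clf_scal scalerA. Qed.

Lemma clf_vecD : {morph @clf_vec R n q : u v / u + v}.
Proof.
move=> u v; rewrite /clf_vec -clf_piD; congr clf_pi; apply: tensor_inj.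
by move=> [|i []] //= *; rewrite ?mxE ?addr0.
Qed.

Lemma clf_vecZ r v : clf_vec q (r *: v) = r *: clf_vec q v.
Proof.
rewrite /clf_vec -clf_piZ; congr clf_pi; apply: tensor_inj.
by move=> [|i []] //= *; rewrite ?mxE ?mulr0.
Qed.

Lemma clf_vec0 : clf_vec q 0 = 0.
Proof. by rewrite -(scale0r 0) clf_vecZ scale0r. Qed.

Lemma clf_vecN v : clf_vec q (- v) = - clf_vec q v.
Proof. by rewrite -scaleN1r clf_vecZ scaleN1r. Qed.

Lemma clf_vec_polar u v :
  clf_vec q u * clf_vec q v + clf_vec q v * clf_vec q u =
  - clf_scal q (polar q u v).
Proof.
have := clf_vec_sqr q (u + v); rewrite clf_vecD mulrDl !mulrDr !clf_vec_sqr.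
rewrite qformD !clf_scalD !opprD => E; apply: (addrI (- clf_scal q (q u))).
apply: (addIr (- clf_scal q (q v))); rewrite [RHS]addrAC -E !addrA.
by [].
Qed.

Lemma clf_scal_zmod_morphism : zmod_morphism (clf_scal q).
Proof. by move=> r s; rewrite clf_scalD clf_scalN. Qed.
HB.instance Definition _ := GRing.isZmodMorphism.Build R (Clf q) (clf_scal q)
  clf_scal_zmod_morphism.
HB.instance Definition _ := GRing.isMonoidMorphism.Build R (Clf q) (clf_scal q)
  (conj clf_scal1 clf_scalM).

Lemma clf_vec_zmod_morphism : zmod_morphism (clf_vec q).
Proof. by move=> u v; rewrite clf_vecD clf_vecN. Qed.
HB.instance Definition _ := GRing.isZmodMorphism.Build 'rV[R]_n (Clf q)
  (clf_vec q) clf_vec_zmod_morphism.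

Fact tshift_subproof s (i : 'I_n) :
  exists N : nat, forall w, (N <= size w)%N -> s (i :: w) = 0.
Proof. by have [N sN] := tensorP s; exists N => w Nw; apply/sN/leqW. Qed.
Definition tshift s i : tensor R n := Tensor (tshift_subproof s i).

Lemma tcoef_sum I (r : seq I) (F : I -> tensor R n) w :
  (\sum_(i <- r) F i) w = \sum_(i <- r) F i w.
Proof. by elim: r => [|i r IHr]; rewrite ?big_nil // !big_cons -IHr. Qed.

(** Words are sorted by their first letter: [tshift s i] collects the coefficients of the words
    starting with [i], with that letter removed. *)
Lemma tensor_decomp s :
  s = s [::] *: (1 : tensor R n)
      + \sum_i tvec (delta_mx 0 i) * tshift s i.
Proof.
apply: tensor_inj => -[|i w]; rewrite /= tcoef_sum.
  by rewrite mulr1 big1 ?addr0 // => i _; rewrite /= tmul_nil mul0r.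
rewrite mulr0 add0r (bigD1 i) //= big1 ?addr0 => [|j ji].
  rewrite tmul_cons mul0r add0r; case: w => [|j w].
    by rewrite tmul_nil /= mxE !eqxx mul1r.
  rewrite tmul_cons /= mxE !eqxx mul1r /tmul_fun big1 ?addr0 // => k _.
  by rewrite mul0r.
rewrite tmul_cons mul0r add0r; apply: big1 => k _.
by case: (take k w) => /= [|? ?]; rewrite ?mul0r // mxE eqxx eq_sym (negPf ji) mul0r.
Qed.

(** A tensor supported on words of length less than [N.+1] is a scalar plus products of a basis
    vector with a tensor of bound [N], by [tensor_decomp]. Identities between additive and
    (anti)multiplicative maps thus reduce to scalars and vectors. *)
Lemma clf_ind (P : Clf q -> Prop) :
  (forall r, P (clf_scal q r)) -> (forall v, P (clf_vec q v)) ->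
  (forall x y, P x -> P y -> P (x + y)) ->
  (forall x y, P x -> P y -> P (x * y)) -> forall x, P x.
Proof.
move=> Ps Pv PD PM x; have [s ->] := clf_piP x; have [N sN] := tensorP s.
elim: N s sN => [|N IHN] s sN.
  suff -> : s = 0 by rewrite clf_pi0 -clf_scal0.
  by apply: tensor_inj => w; apply: sN.
rewrite [s]tensor_decomp clf_piD clf_piZ; apply: (PD); first exact: Ps.
elim/big_ind: _ => [|y z|i _]; first by rewrite clf_pi0 -clf_scal0.
  by rewrite clf_piD; apply: PD.
by rewrite clf_piM; apply/PM/IHN => [|w Nw]; [apply: Pv | apply: sN].
Qed.

Lemma clf_parD : {morph @clf_par R n q : x y / x + y}.
Proof.
move=> x y; have [[s ->] [t ->]] := (clf_piP x, clf_piP y).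
by rewrite -clf_piD !clf_par_pi tparD clf_piD.
Qed.

Lemma clf_parN : {morph @clf_par R n q : x / - x}.
Proof.
by move=> x; have [s ->] := clf_piP x; rewrite -clf_piN !clf_par_pi tparN clf_piN.
Qed.

Lemma clf_parM : {morph @clf_par R n q : x y / x * y}.
Proof.
move=> x y; have [[s ->] [t ->]] := (clf_piP x, clf_piP y).
by rewrite -clf_piM !clf_par_pi tparM clf_piM.
Qed.

Lemma clf_par_scal r : clf_par (clf_scal q r) = clf_scal q r.
Proof. by rewrite /clf_scal -clf_pi1 -clf_piZ clf_par_pi tparZ tpar1. Qed.

Lemma clf_par_vec v : clf_par (clf_vec q v) = - clf_vec q v.
Proof. by rewrite clf_par_pi tpar_vec clf_piN. Qed.

Lemma clf_par_zmod_morphism : zmod_morphism (@clf_par R n q).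
Proof. by move=> x y; rewrite clf_parD clf_parN. Qed.
HB.instance Definition _ := GRing.isZmodMorphism.Build (Clf q) (Clf q)
  (@clf_par R n q) clf_par_zmod_morphism.

Lemma clf_par1 : clf_par (1 : Clf q) = 1.
Proof. by rewrite -clf_scal1 clf_par_scal. Qed.
HB.instance Definition _ := GRing.isMonoidMorphism.Build (Clf q) (Clf q)
  (@clf_par R n q) (conj clf_par1 clf_parM).

Lemma clf_revD : {morph @clf_rev R n q : x y / x + y}.
Proof.
move=> x y; have [[s ->] [t ->]] := (clf_piP x, clf_piP y).
by rewrite -clf_piD !clf_rev_pi trevD clf_piD.
Qed.

Lemma clf_revN : {morph @clf_rev R n q : x / - x}.
Proof.
by move=> x; have [s ->] := clf_piP x; rewrite -clf_piN !clf_rev_pi trevN clf_piN.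
Qed.

Lemma clf_revM x y : clf_rev (x * y) = clf_rev y * clf_rev x.
Proof.
have [[s ->] [t ->]] := (clf_piP x, clf_piP y).
by rewrite -clf_piM !clf_rev_pi trevM clf_piM.
Qed.

Lemma clf_rev_scal r : clf_rev (clf_scal q r) = clf_scal q r.
Proof. by rewrite /clf_scal -clf_pi1 -clf_piZ clf_rev_pi trevZ trev1. Qed.

Lemma clf_rev_vec v : clf_rev (clf_vec q v) = clf_vec q v.
Proof. by rewrite clf_rev_pi trev_vec. Qed.

Lemma clf_parK : involutive (@clf_par R n q).
Proof.
elim/clf_ind => [r|v|x y xK yK|x y xK yK].
- by rewrite !clf_par_scal.
- by rewrite clf_par_vec clf_parN clf_par_vec opprK.
- by rewrite !clf_parD xK yK.
- by rewrite !clf_parM xK yK.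
Qed.

Lemma clf_revK : involutive (@clf_rev R n q).
Proof.
elim/clf_ind => [r|v|x y xK yK|x y xK yK].
- by rewrite !clf_rev_scal.
- by rewrite !clf_rev_vec.
- by rewrite !clf_revD xK yK.
- by rewrite !clf_revM xK yK.
Qed.

Lemma clf_par_rev x : clf_par (clf_rev x) = clf_rev (clf_par x).
Proof.
elim/clf_ind: x => [r|v|x y xK yK|x y xK yK].
- by rewrite !(clf_rev_scal, clf_par_scal).
- by rewrite clf_rev_vec !clf_par_vec clf_revN clf_rev_vec.
- by rewrite !(clf_revD, clf_parD) xK yK.
- by rewrite !(clf_revM, clf_parM) xK yK.
Qed.

Lemma clf_conjK : involutive (@clf_conj R n q).
Proof. by move=> x; rewrite /clf_conj clf_par_rev clf_revK clf_parK. Qed.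

Lemma clf_conjD : {morph @clf_conj R n q : x y / x + y}.
Proof. by move=> x y; rewrite /clf_conj clf_parD clf_revD. Qed.

Lemma clf_conjN : {morph @clf_conj R n q : x / - x}.
Proof. by move=> x; rewrite /clf_conj clf_parN clf_revN. Qed.

Lemma clf_conjM x y : clf_conj (x * y) = clf_conj y * clf_conj x.
Proof. by rewrite /clf_conj clf_parM clf_revM. Qed.

Lemma clf_conj_scal r : clf_conj (clf_scal q r) = clf_scal q r.
Proof. by rewrite /clf_conj clf_par_scal clf_rev_scal. Qed.

Lemma clf_conj_vec v : clf_conj (clf_vec q v) = - clf_vec q v.
Proof. by rewrite /clf_conj clf_par_vec clf_revN clf_rev_vec. Qed.

Lemma clf_rev1 : clf_rev (1 : Clf q) = 1.
Proof. by rewrite -clf_scal1 clf_rev_scal. Qed.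

Lemma is_scalarD x y : is_scalar x -> is_scalar y -> is_scalar (x + y).
Proof. by move=> [r ->] [s ->]; exists (r + s); rewrite clf_scalD. Qed.

Lemma is_scalarN x : is_scalar x -> is_scalar (- x).
Proof. by move=> [r ->]; exists (- r); rewrite clf_scalN. Qed.

Lemma is_scalarZ r x : is_scalar x -> is_scalar (r *: x).
Proof. by move=> [s ->]; exists (r * s); rewrite clf_scalM clf_scalE. Qed.

Lemma is_clfvecD x y : is_clfvec x -> is_clfvec y -> is_clfvec (x + y).
Proof.
move=> [r [u ->]] [s [v ->]]; exists (r + s), (u + v).
by rewrite clf_scalD clf_vecD addrACA.
Qed.

Lemma is_clfvecZ r x : is_clfvec x -> is_clfvec (r *: x).
Proof.
move=> [s [v ->]]; exists (r * s), (r *: v).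
by rewrite clf_scalM clf_scalE clf_vecZ scalerDr.
Qed.

Lemma is_clfvecN x : is_clfvec x -> is_clfvec (- x).
Proof. by rewrite -scaleN1r; apply: is_clfvecZ. Qed.

Lemma is_clfvec0 : is_clfvec (0 : Clf q).
Proof. by exists 0, 0; rewrite clf_scal0 clf_vec0 addr0. Qed.

Lemma is_vectorD x y : is_vector x -> is_vector y -> is_vector (x + y).
Proof. by move=> [u ->] [v ->]; exists (u + v); rewrite clf_vecD. Qed.

Lemma is_vectorZ r x : is_vector x -> is_vector (r *: x).
Proof. by move=> [v ->]; exists (r *: v); rewrite clf_vecZ. Qed.

Lemma is_vector0 : is_vector (0 : Clf q).
Proof. by exists 0; rewrite clf_vec0. Qed.

Section Lift.
Variables (A : pzRingType) (h : {rmorphism R -> A}).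
Variable g : {additive 'rV[R]_n -> A}.
Hypothesis hC : forall r a, h r * a = a * h r.
Hypothesis gZ : forall r v, g (r *: v) = h r * g v.
Hypothesis g_sqr : forall v, g v * g v = - h (q v).

(* Words of length at least N are ignored. *)
Fixpoint teval (N : nat) (s : seq 'I_n -> R) : A :=
  if N is N'.+1 then
    h (s [::]) + \sum_i g (delta_mx 0 i) * teval N' (fun w => s (i :: w))
  else 0.

Lemma eq_teval N (s t : seq 'I_n -> R) : s =1 t -> teval N s = teval N t.
Proof.
elim: N s t => //= N IHN s t st; rewrite st; congr (_ + _).
by apply: eq_bigr => i _; congr (_ * _); apply: IHN => w.
Qed.

Lemma tevalD N (s t : seq 'I_n -> R) :
  teval N (fun w => s w + t w) = teval N s + teval N t.
Proof.
elim: N s t => [|N IHN] s t /=; first by rewrite addr0.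
rewrite rmorphD addrACA -big_split; congr (_ + _).
by apply: eq_bigr => i _; rewrite IHN mulrDr.
Qed.

Lemma tevalZ N r (s : seq 'I_n -> R) :
  teval N (fun w => r * s w) = h r * teval N s.
Proof.
elim: N s => [|N IHN] s /=; first by rewrite mulr0.
rewrite rmorphM mulrDr mulr_sumr; congr (_ + _).
by apply: eq_bigr => i _; rewrite IHN !mulrA hC.
Qed.

Lemma teval0 N (s : seq 'I_n -> R) : (forall w, s w = 0) -> teval N s = 0.
Proof.
elim: N s => //= N IHN s s0; rewrite s0 rmorph0 add0r big1 // => i _.
by rewrite IHN ?mulr0.
Qed.

(** Any length bound for the support of [s] gives the same value, so the choice of a bound in
    [tlift] is immaterial. *)
Lemma teval_stable N M (s : seq 'I_n -> R) :
  (forall w, (N <= size w)%N -> s w = 0) -> (N <= M)%N ->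
  teval M s = teval N s.
Proof.
elim: N M s => [|N IHN] M s sN; first by move=> _; apply: teval0 => w; apply: sN.
case: M => //= M NM; congr (_ + _); apply: eq_bigr => i _; congr (_ * _).
by apply: IHN => // w Nw; apply: sN.
Qed.

(** Induction on the bound of the left factor, removing the first letter with [tmul_cons].
    Centrality of [h] moves the coefficient [s [::]] past [g (delta_mx 0 i)]. *)
Lemma tevalM N M (s t : seq 'I_n -> R) :
  (forall w, (N <= size w)%N -> s w = 0) ->
  (forall w, (M <= size w)%N -> t w = 0) ->
  teval (N + M) (tmul_fun s t) = teval N s * teval M t.
Proof.
elim: N s => [|N IHN] s sN tM.
  by rewrite mul0r teval0 // => w; apply: big1 => i _; rewrite sN ?mul0r.
rewrite /= tmul_nil rmorphM mulrDl mulr_suml.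
under eq_bigr => i _.
  rewrite (@eq_teval _ _ (fun w : seq _ => s [::] * t (i :: w)
             + tmul_fun (fun w' => s (i :: w')) t w)); last first.
    by move=> w; rewrite tmul_cons.
  rewrite tevalD tevalZ IHN //; last by move=> w Nw; apply: sN.
  rewrite mulrDr mulrA -hC -mulrA mulrA; over.
rewrite big_split /= addrA; congr (_ + _); last first.
  by apply: eq_bigr => i _; rewrite mulrA.
(* The bound for [t] is raised so that its evaluation unfolds once and has the same inner bound
   [N + M] as the other side. *)
rewrite -(@teval_stable M (N + M).+1 t tM) /= ?mulrDr ?mulr_sumr; last first.
  by apply: leqW; rewrite leq_addl.
by congr (_ + _); apply: eq_bigr => i _; rewrite mulrA.
Qed.

Definition tlift s : A := teval (sval (cid (tensorP s))) s.

Lemma tliftE N s : (forall w, (N <= size w)%N -> s w = 0) -> tlift s = teval N s.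
Proof.
rewrite /tlift; case: cid => M /= sM sN.
rewrite -(@teval_stable N (maxn M N)) ?leq_maxr //.
by rewrite (@teval_stable M (maxn M N)) ?leq_maxl.
Qed.

Lemma tliftD s t : tlift (s + t) = tlift s + tlift t.
Proof.
have [[M sM] [N tN]] := (tensorP s, tensorP t).
have sMN w : (maxn M N <= size w)%N -> s w = 0.
  by rewrite geq_max => /andP[/sM].
have tMN w : (maxn M N <= size w)%N -> t w = 0.
  by rewrite geq_max => /andP[_ /tN].
rewrite (tliftE sMN) (tliftE tMN) (@tliftE (maxn M N)) ?tevalD // => w MNw.
by rewrite /= sMN ?tMN ?addr0.
Qed.

Lemma tliftM s t : tlift (s * t) = tlift s * tlift t.
Proof.
have [[M sM] [N tN]] := (tensorP s, tensorP t).
rewrite (tliftE sM) (tliftE tN) (@tliftE (M + N)) ?tevalM // => w MNw.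
apply: big1 => i _; have iw : (i <= size w)%N by rewrite -ltnS.
have [Mi|iM] := leqP M i; first by rewrite sM ?mul0r // size_takel.
rewrite tN ?mulr0 // size_drop leq_subRL //.
by apply: leq_trans MNw; rewrite leq_add2r ltnW.
Qed.

Lemma tlift_scal r : tlift (r *: (1 : tensor R n)) = h r.
Proof.
rewrite (@tliftE 1) /= => [|[] //= *]; last by rewrite mulr0.
by rewrite mulr1 big1 ?addr0 // => i _; rewrite mulr0.
Qed.

Lemma tlift_vec v : tlift (tvec v) = g v.
Proof.
rewrite (@tliftE 2) /= => [|[|? []] //]; rewrite rmorph0 add0r.
rewrite [in RHS](row_sum_delta v) raddf_sum; apply: eq_bigr => i _.
by rewrite gZ hC big1 ?addr0 // => j _; rewrite mulr0.
Qed.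

Definition clf_lift x : A := tlift (repr x).

(** The evaluation kills the generators of the ideal by [g_sqr], and being additive and
    multiplicative it kills the whole ideal; hence the representative does not matter. *)
Lemma clf_lift_pi s : clf_lift (clf_pi q s) = tlift s.
Proof.
have tN t : tlift (- t) = - tlift t.
  apply/eqP; rewrite -addr_eq0 -tliftD addNr.
  by rewrite (@tliftE 0) // => w; case: (t w).
rewrite /clf_lift; apply/eqP; rewrite -subr_eq0 -tN -tliftD; apply/eqP.
elim: (clf_ideal_reprN q s) => {s} [v||s t _ Is _ It|s t _ It|s t _ Is].
- by rewrite tliftD tliftM tlift_vec g_sqr tlift_scal addNr.
- exact: (@tliftE 0).
- by rewrite tliftD Is It addr0.
- by rewrite tliftM It mulr0.
- by rewrite tliftM Is mul0r.
Qed.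

(** The central morphism [h] stands for an [R]-algebra structure on [A]. It is applied below with
    [A] a Clifford algebra and with [A] a ring of block matrices. *)
Lemma clf_universal : exists F : {rmorphism Clf q -> A},
  (forall r, F (clf_scal q r) = h r) /\ (forall v, F (clf_vec q v) = g v).
Proof.
have FD : {morph clf_lift : x y / x + y}.
  move=> x y; have [[s ->] [t ->]] := (clf_piP x, clf_piP y).
  by rewrite -clf_piD !clf_lift_pi tliftD.
have FM : {morph clf_lift : x y / x * y}.
  move=> x y; have [[s ->] [t ->]] := (clf_piP x, clf_piP y).
  by rewrite -clf_piM !clf_lift_pi tliftM.
have Fs r : clf_lift (clf_scal q r) = h r.
  by rewrite /clf_scal -clf_pi1 -clf_piZ clf_lift_pi tlift_scal.
have FB : zmod_morphism clf_lift.
  by move=> x y; apply: (addIr (clf_lift y)); rewrite subrK -FD subrK.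
have F1 : monoid_morphism clf_lift.
  by split=> //; rewrite -clf_scal1 Fs rmorph1.
pose fB := GRing.isZmodMorphism.Build _ _ clf_lift FB.
pose fM := GRing.isMonoidMorphism.Build _ _ clf_lift F1.
pose F : {rmorphism Clf q -> A} := HB.pack clf_lift fB fM.
by exists F; split=> // v; rewrite /= clf_lift_pi tlift_vec.
Qed.

End Lift.

End CliffordTheory.

(** * Integrality *)

(** The characteristic polynomial is monic, so Cayley-Hamilton expresses the top power of [P] by the
    lower ones. *)
Lemma mx_integral_nz (R : comNzRingType) m (P : 'M[R]_m.+1) :
  exists N (c : 'I_N -> R),
    iter N (mulmx P) 1%:M = \sum_(i < N) c i *: iter i (mulmx P) 1%:M.
Proof.
have iterE k : iter k (mulmx P) 1%:M = P ^+ k.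
  by elim: k => //= k ->; rewrite exprS.
exists m.+1, (fun i => - (char_poly P)`_i); rewrite iterE.
under eq_bigr do rewrite iterE.
have := Cayley_Hamilton P; rewrite -{1}(coefK (char_poly P)) size_char_poly.
rewrite poly_def rmorph_sum /= big_ord_recr /=.
have /monicP := char_poly_monic P; rewrite lead_coefE size_char_poly /= => lead1.
rewrite lead1 scale1r rmorphXn /= horner_mx_X addrC.
move=> /eqP; rewrite addr_eq0 => /eqP->.
rewrite -sumrN; apply: eq_bigr => i _.
by rewrite horner_mxZ rmorphXn /= horner_mx_X scaleNr.
Qed.

(* The characteristic polynomial is only available over a nonzero ring. *)
Lemma mx_integral (R : comPzRingType) m (P : 'M[R]_m.+1) :
  exists N (c : 'I_N -> R),
    iter N (mulmx P) 1%:M = \sum_(i < N) c i *: iter i (mulmx P) 1%:M.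
Proof.
have [R0|R1] := eqVneq (1 : R) 0.
  (* Over the zero ring all matrices are equal, so the empty relation holds. *)
  exists 0%N, (fun=> 0); apply/matrixP => i j.
  by rewrite -[LHS]mul1r -[RHS]mul1r R0 !mul0r.
pose nz := GRing.PzSemiRing_isNonZero.Build R R1.
pose R' : comNzRingType := HB.pack R (GRing.ComPzRing.class R) nz.
exact: (@mx_integral_nz R' m P).
Qed.

Section FinitelyGenerated.
Variables (R : comPzRingType) (V : lmodType R) (m : nat) (G : 'I_m.+1 -> V).
Hypothesis G_span : forall x, exists c, x = \sum_i c i *: G i.

(** The determinant trick: [f] is described on the generators by some matrix [P], which need not be
    unique as [G] may have relations. A polynomial relation satisfied by [P] is then satisfied by
    [f]. *)
Lemma endo_integral (f : {linear V -> V}) : exists N (c : 'I_N -> R),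
  forall x, iter N f x = \sum_(i < N) c i *: iter i f x.
Proof.
pose P := \matrix_(i, j) sval (cid (G_span (f (G i)))) j.
have fG i : f (G i) = \sum_j P i j *: G j.
  by rewrite {1}(svalP (cid (G_span (f (G i))))); apply: eq_bigr => j _; rewrite mxE.
have iterD k x y : iter k f (x + y) = iter k f x + iter k f y.
  by elim: k => //= k ->; rewrite linearD.
have iterZ k a x : iter k f (a *: x) = a *: iter k f x.
  by elim: k => //= k ->; rewrite linearZ.
have iter0 k : iter k f 0 = 0 by rewrite -(scale0r 0) iterZ !scale0r.
have iter_sum k (c : 'I_m.+1 -> R) (F : 'I_m.+1 -> V) :
    iter k f (\sum_i c i *: F i) = \sum_i c i *: iter k f (F i).
  rewrite (big_morph _ (iterD k) (iter0 k)).
  by apply: eq_bigr => i _; rewrite iterZ.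
have iterG k i : iter k f (G i) = \sum_j (iter k (mulmx P) 1%:M) i j *: G j.
  elim: k i => [|k IHk] i /=.
    rewrite (bigD1 i) //= mxE eqxx scale1r big1 ?addr0 // => j ji.
    by rewrite mxE eq_sym (negPf ji) scale0r.
  rewrite -iterS iterSr fG iter_sum.
  under [LHS]eq_bigr do rewrite IHk scaler_sumr.
  rewrite exchange_big; apply: eq_bigr => l _; rewrite mxE scaler_suml.
  by apply: eq_bigr => j _; rewrite scalerA.
have [N [c PN]] := mx_integral P; exists N, c => x.
have [d ->] := G_span x; rewrite iter_sum.
under [RHS]eq_bigr do rewrite iter_sum scaler_sumr.
rewrite exchange_big; apply: eq_bigr => j _ /=; rewrite iterG PN.
under [RHS]eq_bigr do rewrite scalerA mulrC -scalerA iterG.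
rewrite -scaler_sumr; congr (_ *: _).
under [RHS]eq_bigr do rewrite scaler_sumr.
rewrite exchange_big; apply: eq_bigr => l _; rewrite summxE scaler_suml.
by apply: eq_bigr => i _; rewrite mxE scalerA.
Qed.

(* Multiply an integral equation of g of degree N by the (N-1)-st power of f. *)
Lemma right_inverse_poly (f g : {linear V -> V}) : cancel g f ->
  exists N (c : 'I_N -> R) (e : 'I_N -> nat),
    forall x, g x = \sum_(i < N) c i *: iter (e i) f x.
Proof.
move=> gK; have [[|k] [c gN]] := endo_integral g.
  (* A relation of degree 0 says that every element of [V] is 0. *)
  exists 0%N, c, (fun=> 0%N) => x.
  by have := gN (g x); rewrite !big_ord0.
have iter_add j x y : iter j f (x + y) = iter j f x + iter j f y.
  by elim: j => //= j ->; rewrite linearD.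
have iterZ j a x : iter j f (a *: x) = a *: iter j f x.
  by elim: j => //= j ->; rewrite linearZ.
have iter0 j : iter j f 0 = 0 by rewrite -(scale0r 0) iterZ !scale0r.
have iterK j x : iter j f (iter j g x) = x.
  by elim: j x => //= j IHj x; rewrite -iterS iterSr gK.
(* Applying [f] to the power [k] turns the [k.+1]-st power of [g] into [g], and its [i]-th power
   into the power [k - i] of [f]. *)
exists k.+1, c, (fun i => (k - i)%N) => x.
rewrite -[LHS](iterK k) -iterSr gN (big_morph _ (iter_add k) (iter0 k)).
apply: eq_bigr => i _; rewrite iterZ; congr (_ *: _).
have /subnK kE : (i <= k)%N by rewrite -ltnS.
by rewrite -{1}kE iterD iterK.
Qed.

End FinitelyGenerated.

(** * Finite generation of the Clifford algebra, its even part, and the group structure of Spin *)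

Section SpinGroup.
Variables (R : comPzRingType) (n : nat) (q : qform R n).
Implicit Types (x y z a b : Clf q) (r : R) (u v : 'rV[R]_n).

Local Notation e i := (clf_vec q (delta_mx 0 i)).

(* Combinations of the increasing products of basis vectors in the list l. *)
Fixpoint clf_span (l : seq 'I_n) x : Prop :=
  if l is i :: l' then
    exists y z, [/\ clf_span l' y, clf_span l' z & x = y + e i * z]
  else is_scalar x.

Lemma clf_spanD l x y : clf_span l x -> clf_span l y -> clf_span l (x + y).
Proof.
elim: l x y => [|i l IHl] x y /=; first exact: is_scalarD.
move=> [x1 [x2 [? ? ->]]] [y1 [y2 [? ? ->]]]; exists (x1 + y1), (x2 + y2).
by split; try exact: IHl; rewrite mulrDr addrACA.
Qed.

Lemma clf_spanZ l r x : clf_span l x -> clf_span l (r *: x).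
Proof.
elim: l x => [|i l IHl] x /=; first exact: is_scalarZ.
move=> [y [z [? ? ->]]]; exists (r *: y), (r *: z).
by split; try exact: IHl; rewrite scalerDr clf_scaleAr.
Qed.

Lemma clf_span_scal l r : clf_span l (clf_scal q r).
Proof.
elim: l => [|i l IHl] /=; first by exists r.
exists (clf_scal q r), (0 *: clf_scal q r); split=> //; first exact: clf_spanZ.
by rewrite scale0r mulr0 addr0.
Qed.

(** The factor [e i] moves right past the other basis vectors, up to sign and a scalar polar term,
    until it meets its own place in [l], where its square is a scalar. *)
Lemma clf_span_mul l i x : i \in l -> clf_span l x -> clf_span l (e i * x).
Proof.
elim: l x => // j l IHl x; rewrite inE => ijl [y [z [ly lz ->]]].
rewrite mulrDr mulrA.
have [->|ij] := eqVneq i j.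
  rewrite clf_vec_sqr mulNr clf_scalE; exists (- q (delta_mx 0 j) *: z), y.
  by split; [apply: clf_spanZ | | rewrite scaleNr addrC].
have il : i \in l by move: ijl; rewrite (negPf ij).
have -> : e i * e j = - clf_scal q (polar q (delta_mx 0 i) (delta_mx 0 j)) - e j * e i.
  by rewrite -clf_vec_polar addrK.
set p := polar _ _ _; exists (e i * y + - p *: z), (- 1 *: (e i * z)).
split; first by apply: clf_spanD; [apply: IHl | apply: clf_spanZ].
  by apply/clf_spanZ/IHl.
by rewrite mulrBl mulNr clf_scalE scaleNr scaleN1r mulrN mulrA !addrA.
Qed.

Lemma clf_span_enum x : clf_span (enum 'I_n) x.
Proof.
(* The span contains 1, so stability under left multiplication suffices. *)
suff H y : clf_span (enum 'I_n) y -> clf_span (enum 'I_n) (x * y).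
  by rewrite -[x]mulr1 -clf_scal1; apply/H/clf_span_scal.
elim/clf_ind: x y => [r|v|x y IHx IHy|x y IHx IHy] z zP.
- by rewrite clf_scalE; apply: clf_spanZ.
- rewrite [v]row_sum_delta (big_morph (clf_vec q) (@clf_vecD _ _ q) (clf_vec0 q)).
  rewrite mulr_suml; elim/big_ind: _ => [|? ?|i _].
  + by rewrite -clf_scal0; apply: clf_span_scal.
  + exact: clf_spanD.
  + by rewrite clf_vecZ -clf_scaleAl; apply/clf_spanZ/clf_span_mul/zP/mem_enum.
- by rewrite mulrDl; apply: clf_spanD; [apply: IHx | apply: IHy].
- by rewrite -mulrA; apply/IHx/IHy.
Qed.

Lemma clf_finite : exists m (G : 'I_m.+1 -> Clf q),
  forall x, exists c, x = \sum_i c i *: G i.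
Proof.
suff [m [G GP]] : exists m (G : 'I_m.+1 -> Clf q),
    forall x, clf_span (enum 'I_n) x -> exists c, x = \sum_i c i *: G i.
  by exists m, G => x; apply/GP/clf_span_enum.
elim: (enum 'I_n) => [|i l [m [G GP]]] /=.
  by exists 0%N, (fun=> 1) => x [r ->]; exists (fun=> r); rewrite big_ord1.
(* Each basis vector doubles the generators: [(m + m.+1).+1] is convertible to [m.+1 + m.+1], one
   copy for [y] and one, multiplied by [e i], for [z]. *)
exists (m + m.+1)%N, (fun j : 'I_(m.+1 + m.+1) =>
  match fintype.split j with inl k => G k | inr k => e i * G k end).
move=> x [y [z [/GP[c ->] /GP[d ->] ->]]].
exists (fun j : 'I_(m.+1 + m.+1) =>
  match fintype.split j with inl k => c k | inr k => d k end).
rewrite (@big_split_ord _ _ _ m.+1 m.+1) /=; congr (_ + _).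
  by apply: eq_bigr => k _; rewrite -[lshift _ _]/(unsplit (inl k)) unsplitK.
rewrite mulr_sumr; apply: eq_bigr => k _.
by rewrite -[rshift _ _]/(unsplit (inr k)) unsplitK clf_scaleAr.
Qed.

Lemma clf_right_inverse_poly (f g : Clf q -> Clf q) :
    (forall r x y, f (r *: x + y) = r *: f x + f y) ->
    (forall r x y, g (r *: x + y) = r *: g x + g y) -> cancel g f ->
  exists N (c : 'I_N -> R) (k : 'I_N -> nat),
    forall x, g x = \sum_(i < N) c i *: iter (k i) f x.
Proof.
move=> f_lin g_lin gK; have [m [G GP]] := clf_finite.
pose fL : {linear Clf q -> Clf q} := HB.pack f (GRing.isLinear.Build _ _ _ _ f f_lin).
pose gL : {linear Clf q -> Clf q} := HB.pack g (GRing.isLinear.Build _ _ _ _ g g_lin).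
exact: (right_inverse_poly GP (f := fL) (g := gL)).
Qed.

Lemma clf_mulVC x y : x * y = 1 -> y * x = 1.
Proof.
move=> xy1.
have lin a r (b c : Clf q) : a * (r *: b + c) = r *: (a * b) + a * c.
  by rewrite mulrDr -clf_scaleAr.
(* Left multiplication by [y] is a polynomial in left multiplication by [x]. Evaluation at 1 makes
   [y] a polynomial in [x], so the two commute. *)
have [|N [c [k yE]]] := clf_right_inverse_poly (lin x) (lin y).
  by move=> z; rewrite mulrA xy1 mul1r.
rewrite -[RHS]xy1 -(mulr1 y) yE mulr_suml mulr_sumr; apply: eq_bigr => i _.
rewrite -clf_scaleAl -clf_scaleAr; congr (_ *: _).
elim: (k i) => [|j IHj] /=; first by rewrite mul1r mulr1.
by rewrite -mulrA IHj.
Qed.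

Lemma is_evenD x y : is_even x -> is_even y -> is_even (x + y).
Proof.
move=> [s [sP ->]] [t [tP ->]]; exists (s ++ t); rewrite all_cat sP tP.
by split=> //; rewrite big_cat.
Qed.

Lemma is_even_prod r (l : seq 'rV[R]_n) :
  ~~ odd (size l) -> is_even (r *: \prod_(v <- l) clf_vec q v).
Proof. by move=> lP; exists [:: (r, l)]; rewrite /= lP big_seq1. Qed.

Lemma is_even_scal r : is_even (clf_scal q r).
Proof. by have := @is_even_prod r [::] isT; rewrite big_nil. Qed.

Lemma is_even_vec2 u v : is_even (clf_vec q u * clf_vec q v).
Proof.
by have := @is_even_prod 1 [:: u; v] isT; rewrite big_cons big_seq1 scale1r.
Qed.

Lemma is_even_sum (I : eqType) (s : seq I) (F : I -> Clf q) :
  {in s, forall i, is_even (F i)} -> is_even (\sum_(i <- s) F i).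
Proof.
move=> FP; rewrite big_seq; elim/big_ind: _ => //; last exact: is_evenD.
by rewrite -clf_scal0; apply: is_even_scal.
Qed.

Lemma is_evenM x y : is_even x -> is_even y -> is_even (x * y).
Proof.
move=> [s [/allP sP ->]] [t [/allP tP ->]]; rewrite mulr_suml.
apply: is_even_sum => p ps; rewrite mulr_sumr; apply: is_even_sum => p' pt.
rewrite -clf_scaleAl -clf_scaleAr scalerA -big_cat; apply: is_even_prod.
by rewrite size_cat oddD (negPf (sP p ps)) (negPf (tP p' pt)).
Qed.

Lemma is_evenN x : is_even x -> is_even (- x).
Proof.
rewrite -scaleN1r -clf_scalE; apply: is_evenM; exact: is_even_scal.
Qed.

(** Grouping the factors of an even product in consecutive pairs shows that scalars and products of
    two vectors generate the even part. *)
Lemma is_even_ind (P : Clf q -> Prop) :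
  (forall r, P (clf_scal q r)) -> (forall u v, P (clf_vec q u * clf_vec q v)) ->
  (forall x y, P x -> P y -> P (x + y)) ->
  (forall x y, P x -> P y -> P (x * y)) -> forall x, is_even x -> P x.
Proof.
move=> Ps Pv PD PM _ [s [sP ->]]; elim: s sP => [|[r l] s IHs] /=.
  by rewrite big_nil -clf_scal0.
move=> /andP[lP /IHs Ps']; rewrite big_cons; apply: (PD) => {s IHs Ps'}//=.
rewrite -clf_scalE; apply: (PM) => //.
have [k] := ubnP (size l); elim: k l lP => // k IHk [|u [|v l]] //= lP lk.
  by rewrite big_nil -clf_scal1.
rewrite !big_cons mulrA; apply: (PM) => //; apply: IHk; last exact: ltnW.
by rewrite negbK in lP.
Qed.

Lemma is_even_rev x : is_even x -> is_even (clf_rev x).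
Proof.
elim/is_even_ind: x / => [r|u v|x y xP yP|x y xP yP].
- by rewrite clf_rev_scal; apply: is_even_scal.
- by rewrite clf_revM !clf_rev_vec; apply: is_even_vec2.
- by rewrite clf_revD; apply: is_evenD.
- by rewrite clf_revM; apply: is_evenM.
Qed.

Lemma clf_par_even x : is_even x -> clf_par x = x.
Proof.
elim/is_even_ind: x / => [r|u v|x y xP yP|x y xP yP].
- by rewrite clf_par_scal.
- by rewrite clf_parM !clf_par_vec mulrNN.
- by rewrite clf_parD xP yP.
- by rewrite clf_parM xP yP.
Qed.

(** On even elements Clifford conjugation is the transpose, so the norm [a * clf_conj a] is 1; and
    [a * clf_rev a = 1] fixes scalars under the action of [a], which reduces stability of the
    Clifford vectors to that of the vectors. *)
Lemma SpinP a : Spin a <-> [/\ is_even a, a * clf_rev a = 1 &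
  forall v, is_vector (a * clf_vec q v * clf_rev a)].
Proof.
split=> [[ev _ a1 aV]|[ev a1 aV]].
  by split=> // v; apply: aV; exists v.
split=> //; last by move=> _ [v ->].
split; first by exists 1; rewrite /clf_conj clf_par_even ?clf_scal1.
move=> _ [r [v ->]]; have [u uE] := aV v; exists r, u.
rewrite mulrDr mulrDl uE; congr (_ + _).
by rewrite -clf_scalC clf_scalE -clf_scaleAl a1.
Qed.

Lemma Spin1 : Spin (1 : Clf q).
Proof.
apply/SpinP; rewrite clf_rev1 mulr1 -clf_scal1; split=> //.
  exact: is_even_scal.
by move=> v; exists v; rewrite clf_scal1 mul1r mulr1.
Qed.

Lemma SpinM a b : Spin a -> Spin b -> Spin (a * b).
Proof.
move=> /SpinP[ea a1 aV] /SpinP[eb b1 bV]; apply/SpinP; rewrite clf_revM.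
split; first exact: is_evenM.
  by rewrite mulrA -(mulrA a) b1 mulr1.
move=> v; have [u uE] := bV v; have [w wE] := aV u; exists w.
by rewrite -wE -uE !mulrA.
Qed.

Lemma Spin_rev a : Spin a -> Spin (clf_rev a).
Proof.
move=> /SpinP[ea a1 aV]; apply/SpinP; rewrite clf_revK.
have a1' : clf_rev a * a = 1 by apply: clf_mulVC.
split=> //; first exact: is_even_rev.
have lin b c r x y : b * (r *: x + y) * c = r *: (b * x * c) + b * y * c.
  by rewrite mulrDr mulrDl -clf_scaleAr -clf_scaleAl.
(* The map [z |-> clf_rev a * z * a] is a right inverse of [z |-> a * z * clf_rev a], hence a
   polynomial in it, and iterates of the latter preserve vectors. *)
have [|N [c [k E]]] :=
    clf_right_inverse_poly (lin a (clf_rev a)) (lin (clf_rev a) a).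
  by move=> z; rewrite !mulrA a1 mul1r -mulrA a1 mulr1.
move=> v; rewrite E; elim/big_ind: _ => [||i _].
- exact: is_vector0.
- exact: is_vectorD.
apply: is_vectorZ; elim: (k i) => [|j [u uE]] /=; first by exists v.
by rewrite uE; apply: aV.
Qed.

Lemma Spin_group : is_mul_group (@Spin R n q).
Proof.
split; [exact: Spin1 | exact: SpinM | move=> a aP].
have /SpinP[_ a1 _] := aP.
by exists (clf_rev a); split=> //; [apply: Spin_rev | apply: clf_mulVC].
Qed.

End SpinGroup.

(** * The isomorphism with two-by-two matrices *)

Section MatrixTwo.
Variable A : pzRingType.

Definition mx2 (a b c d : A) : 'M[A]_2 :=
  \matrix_(i, j) if i == 0 then (if j == 0 then a else b)
                 else (if j == 0 then c else d).

Lemma mx2_00 a b c d : mx2 a b c d 0 0 = a. Proof. by rewrite mxE. Qed.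
Lemma mx2_01 a b c d : mx2 a b c d 0 1 = b. Proof. by rewrite mxE. Qed.
Lemma mx2_10 a b c d : mx2 a b c d 1 0 = c. Proof. by rewrite mxE. Qed.
Lemma mx2_11 a b c d : mx2 a b c d 1 1 = d. Proof. by rewrite mxE. Qed.
Definition mx2E := (mx2_00, mx2_01, mx2_10, mx2_11).

Lemma forall_ord2 (P : 'I_2 -> Prop) : P 0 -> P 1 -> forall i, P i.
Proof.
move=> P0 P1 [[|[|//]] i2].
  by have -> : Ordinal i2 = 0 by apply: val_inj.
by have -> : Ordinal i2 = 1 by apply: val_inj.
Qed.

Lemma eq_mx2 (M N : 'M[A]_2) : M 0 0 = N 0 0 -> M 0 1 = N 0 1 ->
  M 1 0 = N 1 0 -> M 1 1 = N 1 1 -> M = N.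
Proof.
by move=> *; apply/matrixP; apply: forall_ord2; apply: forall_ord2.
Qed.

Lemma mx2_eta (M : 'M[A]_2) : M = mx2 (M 0 0) (M 0 1) (M 1 0) (M 1 1).
Proof. by apply: eq_mx2; rewrite mx2E. Qed.

Lemma mul2E (M N : 'M[A]_2) i j :
  (M * N) i j = M i 0 * N 0 j + M i 1 * N 1 j.
Proof.
rewrite mxE big_ord_recl big_ord1; congr (_ * _ + M _ _ * N _ _);
exact: val_inj.
Qed.

Lemma mx2M a b c d a' b' c' d' : mx2 a b c d * mx2 a' b' c' d' =
  mx2 (a * a' + b * c') (a * b' + b * d') (c * a' + d * c') (c * b' + d * d').
Proof. by apply: eq_mx2; rewrite mul2E !mx2E. Qed.

Lemma mx2D a b c d a' b' c' d' : mx2 a b c d + mx2 a' b' c' d' =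
  mx2 (a + a') (b + b') (c + c') (d + d').
Proof. by apply: eq_mx2; rewrite mxE !mx2E. Qed.

Lemma mx2N a b c d : - mx2 a b c d = mx2 (- a) (- b) (- c) (- d).
Proof. by apply: eq_mx2; rewrite mxE !mx2E. Qed.

Lemma mx2_scalar a : a%:M = mx2 a 0 0 a.
Proof. by apply: eq_mx2; rewrite mxE !mx2E. Qed.

Lemma mx2_1 : 1 = mx2 1 0 0 1. Proof. exact: mx2_scalar. Qed.
End MatrixTwo.

Lemma map_mx2 (A B : pzRingType) (f : A -> B) a b c d :
  map_mx f (mx2 a b c d) = mx2 (f a) (f b) (f c) (f d).
Proof. by apply: eq_mx2; rewrite mxE !mx2E. Qed.

(* u, v generate a copy of M_2(Z) in which u = E_12 and v = E_21. *)
Section MatrixUnits.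
Variables (A C : pzRingType) (k : {rmorphism C -> A}) (u v : A).
Hypothesis uk : forall x, u * k x = k x * u.
Hypothesis vk : forall x, v * k x = k x * v.
Hypothesis uu : u * u = 0.
Hypothesis vv : v * v = 0.
Hypothesis uv : u * v + v * u = 1.

(** The idempotents [u * v] and [v * u] are E_11 and E_22. *)
Definition mxunits (M : 'M[C]_2) : A :=
  k (M 0 0) * (u * v) + k (M 0 1) * u + k (M 1 0) * v + k (M 1 1) * (v * u).

Lemma mxunitsD : {morph mxunits : M N / M + N}.
Proof.
move=> M N; rewrite /mxunits !mxE !rmorphD /= !mulrDl.
rewrite [RHS]addrACA; congr (_ + _); rewrite [RHS]addrACA; congr (_ + _).
by rewrite addrACA.
Qed.

Let uvu : u * v * u = u.
Proof.
have -> : u * v = 1 - v * u by rewrite -uv addrK.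
by rewrite mulrBl mul1r -mulrA uu mulr0 subr0.
Qed.

Let vuv : v * u * v = v.
Proof.
have -> : v * u = 1 - u * v by rewrite -uv addrAC subrr add0r.
by rewrite mulrBl mul1r -mulrA vv mulr0 subr0.
Qed.

Lemma mxunitsM : {morph mxunits : M N / M * N}.
Proof.
move=> M N; have uvk x : u * v * k x = k x * (u * v).
  by rewrite -mulrA vk mulrA uk -mulrA.
have vuk x : v * u * k x = k x * (v * u).
  by rewrite -mulrA uk mulrA vk -mulrA.
have mulE S T a b : S * k b = k b * S -> (k a * S) * (k b * T) = k (a * b) * (S * T).
  by move=> Sb; rewrite -!mulrA rmorphM (mulrA S) Sb !mulrA.
rewrite /mxunits !mul2E !rmorphD /= !mulrDl !mulrDr.
rewrite !(mulE _ _ _ _ (uvk _)) !(mulE _ _ _ _ (uk _)).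
rewrite !(mulE _ _ _ _ (vuk _)) !(mulE _ _ _ _ (vk _)).
(* Since the coefficients commute with the units, the multiplication table of the matrix units
   remains, grouped by the left factor. *)
have tab_uv : (u * v * (u * v) = u * v) * (u * v * u = u) *
    (u * v * v = 0) * (u * v * (v * u) = 0).
  do !split=> //; first by rewrite mulrA uvu.
    by rewrite -mulrA vv mulr0.
  by rewrite mulrA -(mulrA u v v) vv mulr0 mul0r.
have tab_u : (u * (u * v) = 0) * (u * (v * u) = u).
  by split; rewrite mulrA ?uu ?mul0r.
have tab_v : (v * (u * v) = v) * (v * (v * u) = 0).
  by split; rewrite mulrA ?vv ?mul0r.
have tab_vu : (v * u * (u * v) = 0) * (v * u * u = 0) *
    (v * u * v = v) * (v * u * (v * u) = v * u).
  do !split=> //; last by rewrite mulrA vuv.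
    by rewrite mulrA -(mulrA v u u) uu mulr0 mul0r.
  by rewrite -mulrA uu mulr0.
rewrite !(tab_uv, tab_u, tab_v, tab_vu, uu, vv) !(mulr0, addr0, add0r).
rewrite addrACA !addrA; congr (_ + _ + _); rewrite -!addrA; congr (_ + _).
rewrite addrCA; do 3!congr (_ + _); exact: addrC.
Qed.

Lemma mxunits1 : mxunits 1 = 1.
Proof. by rewrite /mxunits mx2_1 !mx2E !(rmorph0, rmorph1) !(mul0r, mul1r) !addr0. Qed.

Lemma mxunits_mx2 a b c d : mxunits (mx2 a b c d) =
  k a * (u * v) + k b * u + k c * v + k d * (v * u).
Proof. by rewrite /mxunits !mx2E. Qed.

Lemma mxunits_diag a : mxunits (mx2 a 0 0 a) = k a.
Proof. by rewrite mxunits_mx2 !rmorph0 !mul0r !addr0 -mulrDr uv mulr1. Qed.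

End MatrixUnits.

(** * Two-by-two matrices over Clf(q) inside Clf(Q) *)

Section SpinMatrix.
Variables (R : comPzRingType) (n : nat) (q : qform R n) (Q : qform R (3 + n)).
(** Only the values of [Q] are prescribed: it will be the base change of an integral orthogonal sum,
    which satisfies this equation by [qform_over_sum]. *)
Hypothesis QE : forall u w, Q (row_mx u w) = qform_xyz R u + q w.

Let C := Clf q.
Let D := Clf Q.

Definition ex : D := clf_vec Q (row_mx (delta_mx 0 0) 0).
Definition ey : D := clf_vec Q (row_mx (delta_mx 0 1) 0).
Definition ez : D := clf_vec Q (row_mx (delta_mx 0 2) 0).
Definition vec_incl (w : 'rV[R]_n) : D := clf_vec Q (row_mx 0 w).

Let vec_inclB : zmod_morphism vec_incl.
Proof.
by move=> u v; rewrite /vec_incl -raddfB /= opp_row_mx add_row_mx subrr.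
Qed.
HB.instance Definition _ := GRing.isZmodMorphism.Build 'rV[R]_n D vec_incl vec_inclB.

Lemma vec_inclZ r w : vec_incl (r *: w) = r *: vec_incl w.
Proof. by rewrite -clf_vecZ scale_row_mx scaler0. Qed.

Lemma row3_decomp (u : 'rV[R]_3) : u = u 0 0 *: delta_mx 0 0
  + u 0 1 *: delta_mx 0 1 + u 0 2 *: delta_mx 0 2.
Proof.
rewrite [LHS]row_sum_delta !big_ord_recr big_ord0 /= add0r.
by do 2?congr (_ + _); congr (u _ _ *: delta_mx _ _); apply: val_inj.
Qed.

Lemma clf_vec_row u w : clf_vec Q (row_mx u w) =
  u 0 0 *: ex + u 0 1 *: ey + u 0 2 *: ez + vec_incl w.
Proof.
rewrite -!clf_vecZ -!clf_vecD !scale_row_mx !add_row_mx !scaler0 !addr0 add0r.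
by rewrite -row3_decomp.
Qed.

Let Q0 : qform_xyz R 0 = 0. Proof. exact: qform0. Qed.
Let q0 : q 0 = 0. Proof. exact: qform0. Qed.

Lemma ex_sqr : ex * ex = -1.
Proof.
rewrite clf_vec_sqr QE q0 addr0 /= /qform_xyz_fun !mxE /=.
by rewrite mulr0 addr0 expr1n clf_scal1.
Qed.

Lemma ey_sqr : ey * ey = 0.
Proof.
rewrite clf_vec_sqr QE q0 addr0 /= /qform_xyz_fun !mxE /=.
by rewrite mulr0 addr0 expr0n clf_scal0 oppr0.
Qed.

Lemma ez_sqr : ez * ez = 0.
Proof.
rewrite clf_vec_sqr QE q0 addr0 /= /qform_xyz_fun !mxE /=.
by rewrite mul0r addr0 expr0n clf_scal0 oppr0.
Qed.

Lemma vec_incl_sqr w : vec_incl w * vec_incl w = - clf_scal Q (q w).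
Proof. by rewrite clf_vec_sqr QE Q0 add0r. Qed.

Let polar_xyz u v w : polar Q (row_mx u 0) (row_mx v w) =
  polar (qform_xyz R) u v.
Proof.
rewrite /polar add_row_mx add0r !QE q0 addr0.
by ring.
Qed.

Let anticomm (u v : 'rV[R]_(3 + n)) : polar Q u v = 0 ->
  clf_vec Q u * clf_vec Q v = - (clf_vec Q v * clf_vec Q u).
Proof.
by move=> uv0; apply/eqP; rewrite -addr_eq0 clf_vec_polar uv0 clf_scal0 oppr0.
Qed.

Lemma ey_ex : ey * ex = - (ex * ey).
Proof.
apply: anticomm; rewrite polar_xyz /polar /= /qform_xyz_fun !mxE /=.
by rewrite !(mulr0, mul0r, addr0, add0r, expr1n, expr0n) /= subr0 subrr.
Qed.

Lemma ez_ex : ez * ex = - (ex * ez).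
Proof.
apply: anticomm; rewrite polar_xyz /polar /= /qform_xyz_fun !mxE /=.
by rewrite !(mulr0, mul0r, addr0, add0r, expr1n, expr0n) /= subr0 subrr.
Qed.

Lemma ez_ey : ey * ez + ez * ey = -1.
Proof.
rewrite clf_vec_polar polar_xyz /polar /= /qform_xyz_fun !mxE /=.
rewrite !(mulr0, mul0r, addr0, add0r, expr1n, expr0n, mulr1) /=.
by rewrite !(subr0, add0r) clf_scal1.
Qed.

Let polar_xyz0 u : polar (qform_xyz R) u 0 = 0.
Proof. by rewrite polarC polar0l. Qed.

Lemma vec_incl_ex w : vec_incl w * ex = - (ex * vec_incl w).
Proof. by apply: anticomm; rewrite polarC polar_xyz polar_xyz0. Qed.
Lemma vec_incl_ey w : vec_incl w * ey = - (ey * vec_incl w).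
Proof. by apply: anticomm; rewrite polarC polar_xyz polar_xyz0. Qed.
Lemma vec_incl_ez w : vec_incl w * ez = - (ez * vec_incl w).
Proof. by apply: anticomm; rewrite polarC polar_xyz polar_xyz0. Qed.

Definition e12 : D := locked (ex * ey).
Lemma e12E : e12 = ex * ey. Proof. by rewrite /e12 -lock. Qed.
(** The sign compensates [ey * ez + ez * ey = -1], so that the two diagonal idempotents add up to
    1. *)
Definition e21 : D := locked (- (ex * ez)).
Lemma e21E : e21 = - (ex * ez). Proof. by rewrite /e21 -lock. Qed.

Let exyxz a b : a * ex = - (ex * a) -> (ex * a) * (ex * b) = a * b.
Proof.
by move=> aex; rewrite mulrA -(mulrA ex) aex mulrN mulrA ex_sqr mulN1r opprK.
Qed.

Lemma e12_sqr : e12 * e12 = 0.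
Proof. by rewrite e12E exyxz ?ey_ex ?ey_sqr. Qed.

Lemma e21_sqr : e21 * e21 = 0.
Proof. by rewrite e21E mulrNN exyxz ?ez_ex ?ez_sqr. Qed.

Lemma e11E : e12 * e21 = - (ey * ez).
Proof. by rewrite e12E e21E mulrN exyxz ?ey_ex. Qed.

Lemma e22E : e21 * e12 = - (ez * ey).
Proof. by rewrite e12E e21E mulNr exyxz ?ez_ex. Qed.

Lemma e12_e21 : e12 * e21 + e21 * e12 = 1.
Proof. by rewrite e11E e22E -opprD ez_ey opprK. Qed.

Lemma e12_ex : e12 * ex = - (ex * e12).
Proof. by rewrite e12E -mulrA ey_ex mulrN. Qed.
Lemma e21_ex : e21 * ex = - (ex * e21).
Proof. by rewrite e21E mulNr -mulrA ez_ex !mulrN. Qed.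

Lemma e12_incl w : e12 * vec_incl w = vec_incl w * e12.
Proof. by rewrite e12E mulrA vec_incl_ex mulNr -!mulrA vec_incl_ey mulrN opprK. Qed.
Lemma e21_incl w : e21 * vec_incl w = vec_incl w * e21.
Proof.
by rewrite e21E mulNr mulrN mulrA vec_incl_ex mulNr -!mulrA vec_incl_ez mulrN opprK.
Qed.

(* A volume element of the ternary form. *)
Definition omega : D := locked (ex * (e12 * e21 - e21 * e12)).
Lemma omegaE : omega = ex * (e12 * e21 - e21 * e12).
Proof. by rewrite /omega -lock. Qed.

Let uvu : e12 * e21 * e12 = e12.
Proof.
have -> : e12 * e21 = 1 - e21 * e12 by rewrite -e12_e21 addrK.
by rewrite mulrBl mul1r -mulrA e12_sqr mulr0 subr0.
Qed.
Let vuv : e21 * e12 * e21 = e21.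
Proof.
have -> : e21 * e12 = 1 - e12 * e21 by rewrite -e12_e21 addrAC subrr add0r.
by rewrite mulrBl mul1r -mulrA e21_sqr mulr0 subr0.
Qed.

(** This is diag(1, -1). It commutes with [ex] and anticommutes with [e12] and [e21], as [ex] does
    with the latter two; so [omega], which is [ex * s], commutes with all three. *)
Let s := e12 * e21 - e21 * e12.

Let s_ex : s * ex = ex * s.
Proof.
rewrite /s mulrBl mulrBr; congr (_ - _).
  by rewrite -mulrA e21_ex mulrN mulrA e12_ex mulNr opprK mulrA.
by rewrite -mulrA e12_ex mulrN mulrA e21_ex mulNr opprK mulrA.
Qed.

Let su : s * e12 = e12.
Proof. by rewrite /s mulrBl uvu -mulrA e12_sqr mulr0 subr0. Qed.
Let us : e12 * s = - e12.
Proof. by rewrite /s mulrBr !mulrA uvu e12_sqr mul0r sub0r. Qed.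
Let sv : s * e21 = - e21.
Proof. by rewrite /s mulrBl vuv -mulrA e21_sqr mulr0 sub0r. Qed.
Let vs : e21 * s = e21.
Proof. by rewrite /s mulrBr !mulrA vuv e21_sqr mul0r subr0. Qed.

Let s_sqr : s * s = 1.
Proof. by rewrite {2}/s mulrBr !mulrA su sv mulNr opprK e12_e21. Qed.

Let s_incl w : s * vec_incl w = vec_incl w * s.
Proof.
rewrite /s mulrBl mulrBr -!mulrA e12_incl e21_incl !mulrA.
by rewrite e12_incl e21_incl.
Qed.

Lemma omega_sqr : omega * omega = -1.
Proof. by rewrite omegaE -/s mulrA -(mulrA ex) s_ex mulrA ex_sqr -mulrA s_sqr mulr1. Qed.

Lemma ex_omega : ex * omega = - s.
Proof. by rewrite omegaE -/s mulrA ex_sqr mulN1r. Qed.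

Lemma vec_incl_omega w : vec_incl w * omega = - (omega * vec_incl w).
Proof. by rewrite omegaE -/s mulrA vec_incl_ex mulNr -!mulrA s_incl. Qed.

Lemma e12_omega : e12 * omega = omega * e12.
Proof.
by rewrite omegaE -/s mulrA e12_ex mulNr -!mulrA us su mulrN opprK.
Qed.

Lemma e21_omega : e21 * omega = omega * e21.
Proof.
by rewrite omegaE -/s mulrA e21_ex mulNr -!mulrA vs sv mulrN.
Qed.

Lemma ey_omega : ey * omega = e12.
Proof.
have -> : ey = - (ex * e12) by rewrite e12E mulrA ex_sqr mulN1r opprK.
rewrite mulNr -mulrA e12_omega mulrA ex_omega mulNr opprK; exact: su.
Qed.

Lemma ez_omega : ez * omega = e21.
Proof.
have -> : ez = ex * e21 by rewrite e21E mulrN mulrA ex_sqr mulN1r opprK.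
rewrite -mulrA e21_omega mulrA ex_omega mulNr sv; exact: opprK.
Qed.

Let kvec w : D := omega * vec_incl w.
Let kvecB : zmod_morphism kvec.
Proof. by move=> w w'; rewrite /kvec raddfB mulrBr. Qed.
HB.instance Definition _ := GRing.isZmodMorphism.Build 'rV[R]_n D kvec kvecB.

(** As [omega] anticommutes with [vec_incl w] and squares to -1, [omega * vec_incl w] has the same
    square as [vec_incl w]. *)
Lemma kmor_exists : exists F : {rmorphism C -> D},
  (forall r, F (clf_scal q r) = clf_scal Q r) /\
  (forall w, F (clf_vec q w) = omega * vec_incl w).
Proof.
apply: (clf_universal (g := kvec)) => [r a|r w|w].
- exact: clf_scalC.
- by rewrite /= /kvec vec_inclZ -clf_scaleAr clf_scalE.
- rewrite /= /kvec mulrA -(mulrA omega) vec_incl_omega mulrN mulNr mulrA omega_sqr.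
  by rewrite mulN1r mulNr opprK vec_incl_sqr.
Qed.

Definition kmor : {rmorphism C -> D} := sval (cid kmor_exists).

Lemma kmor_scal r : kmor (clf_scal q r) = clf_scal Q r.
Proof. exact: (svalP (cid kmor_exists)).1. Qed.

Lemma kmor_vec w : kmor (clf_vec q w) = omega * vec_incl w.
Proof. exact: (svalP (cid kmor_exists)).2. Qed.

Lemma e12_kmor a : e12 * kmor a = kmor a * e12.
Proof.
elim/clf_ind: a => [r|w|x y xP yP|x y xP yP].
- by rewrite kmor_scal clf_scalC.
- by rewrite kmor_vec mulrA e12_omega -!mulrA e12_incl.
- by rewrite rmorphD mulrDl mulrDr xP yP.
- by rewrite rmorphM /= mulrA xP -!mulrA yP.
Qed.

Lemma e21_kmor a : e21 * kmor a = kmor a * e21.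
Proof.
elim/clf_ind: a => [r|w|x y xP yP|x y xP yP].
- by rewrite kmor_scal clf_scalC.
- by rewrite kmor_vec mulrA e21_omega -!mulrA e21_incl.
- by rewrite rmorphD mulrDl mulrDr xP yP.
- by rewrite rmorphM /= mulrA xP -!mulrA yP.
Qed.

Definition psi : 'M[C]_2 -> D := mxunits kmor e12 e21.

Lemma psiD : {morph psi : M N / M + N}.
Proof. exact: mxunitsD. Qed.

Lemma psiM : {morph psi : M N / M * N}.
Proof.
exact: mxunitsM e12_kmor e21_kmor e12_sqr e21_sqr e12_e21.
Qed.

Lemma psi1 : psi 1 = 1.
Proof. exact: mxunits1 e12_e21. Qed.

Lemma psi_scal r : psi (mx2 (clf_scal q r) 0 0 (clf_scal q r)) = clf_scal Q r.
Proof. by rewrite /psi mxunits_diag ?kmor_scal //; apply: e12_e21. Qed.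

Lemma rev_ex : clf_rev ex = ex. Proof. exact: clf_rev_vec. Qed.

Lemma rev_e12 : clf_rev e12 = - e12.
Proof. by rewrite e12E clf_revM !clf_rev_vec -/ex -/ey ey_ex. Qed.

Lemma rev_e21 : clf_rev e21 = - e21.
Proof. by rewrite e21E clf_revN clf_revM !clf_rev_vec -/ex -/ez ez_ex. Qed.

Lemma rev_omega : clf_rev omega = - omega.
Proof.
rewrite omegaE -/s clf_revM rev_ex /s clf_revD clf_revN !clf_revM.
rewrite rev_e12 rev_e21 !mulrNN -opprB -/s mulNr.
by rewrite s_ex.
Qed.

Lemma rev_kmor a : clf_rev (kmor a) = kmor (clf_rev a).
Proof.
elim/clf_ind: a => [r|w|x y xP yP|x y xP yP].
- by rewrite clf_rev_scal kmor_scal clf_rev_scal.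
- rewrite clf_rev_vec kmor_vec clf_revM rev_omega clf_rev_vec mulrN.
  by rewrite vec_incl_omega opprK.
- by rewrite rmorphD /= !clf_revD xP yP rmorphD.
- by rewrite rmorphM /= !clf_revM xP yP rmorphM.
Qed.

Definition adjs (M : 'M[C]_2) : 'M[C]_2 :=
  mx2 (clf_rev (M 1 1)) (- clf_rev (M 0 1)) (- clf_rev (M 1 0)) (clf_rev (M 0 0)).

(** The transpose negates [e12] and [e21] and, reversing products, exchanges the two diagonal
    idempotents, while it commutes with [kmor]. *)
Lemma rev_psi M : clf_rev (psi M) = psi (adjs M).
Proof.
have uvk x : e12 * e21 * kmor x = kmor x * (e12 * e21).
  by rewrite -mulrA e21_kmor mulrA e12_kmor -mulrA.
have vuk x : e21 * e12 * kmor x = kmor x * (e21 * e12).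
  by rewrite -mulrA e12_kmor mulrA e21_kmor -mulrA.
rewrite /psi /adjs mxunits_mx2 /mxunits !clf_revD !clf_revM !rev_kmor.
rewrite rev_e12 rev_e21 !mulrNN uvk vuk !mulNr e12_kmor e21_kmor !rmorphN /= !mulNr.
rewrite addrC -!addrA; congr (_ + _).
by rewrite addrC -addrA.
Qed.

(** [omega] anticommutes with the images [omega * vec_incl w] of the vectors, so conjugation by it
    is the parity automorphism on the image of [kmor]. *)
Lemma omega_kmor a : omega * kmor a = kmor (clf_par a) * omega.
Proof.
elim/clf_ind: a => [r|w|x y xP yP|x y xP yP].
- by rewrite clf_par_scal kmor_scal clf_scalC.
- by rewrite clf_par_vec rmorphN /= kmor_vec mulNr -mulrA vec_incl_omega mulrN opprK.
- by rewrite clf_parD !rmorphD /= mulrDl mulrDr xP yP.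
- by rewrite clf_parM !rmorphM /= mulrA xP -!mulrA yP.
Qed.

Lemma omega_psi M : omega * psi M = psi (map_mx (@clf_par _ _ q) M) * omega.
Proof.
have ou : e12 * omega = omega * e12 := e12_omega.
have ov : e21 * omega = omega * e21 := e21_omega.
have mE a S : S * omega = omega * S ->
    omega * (kmor a * S) = kmor (clf_par a) * S * omega.
  by move=> oS; rewrite mulrA omega_kmor -!mulrA oS.
rewrite /psi /mxunits !mxE !mulrDr !mulrDl !mE //.
  by rewrite -mulrA ou mulrA ov -mulrA.
by rewrite -mulrA ov mulrA ou -mulrA.
Qed.

Definition vahlen_vec (xi : C) (y z : R) : 'M[C]_2 :=
  mx2 xi (clf_scal q y) (clf_scal q z) (- clf_conj xi).

(** The signs come from [ex * omega = - s] and from [vec_incl w * omega = - (omega * vec_incl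
    w)]. *)
Definition xi_of (v : 'rV[R]_(3 + n)) : C :=
  - clf_scal q (lsubmx v 0 0) - clf_vec q (rsubmx v).

Definition vmx (v : 'rV[R]_(3 + n)) : 'M[C]_2 :=
  vahlen_vec (xi_of v) (lsubmx v 0 1) (lsubmx v 0 2).

Lemma conj_xi v : - clf_conj (xi_of v) =
  clf_scal q (lsubmx v 0 0) - clf_vec q (rsubmx v).
Proof.
rewrite /xi_of clf_conjD !clf_conjN clf_conj_scal clf_conj_vec opprD !opprK.
by [].
Qed.

Lemma psi_vmx v : psi (vmx v) = clf_vec Q v * omega.
Proof.
rewrite /psi /vmx /vahlen_vec mxunits_mx2 conj_xi /xi_of.
rewrite -[v in clf_vec Q v]hsubmxK clf_vec_row !mulrDl -!clf_scaleAl.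
rewrite ex_omega ey_omega ez_omega vec_incl_omega !kmor_scal.
rewrite !(rmorphD, rmorphN) /= !kmor_scal kmor_vec !mulrDl.
rewrite !mulNr !clf_scalE scalerN /s scalerBr opprB.
rewrite -[omega * _ in RHS]mulr1 -e12_e21 mulrDr opprD.
by rewrite [LHS](AC (4*2) (5*1*3*4*(2*6))).
Qed.

Let omegaI x y : x * omega = y * omega -> x = y.
Proof.
move=> /(congr1 (fun z => - (z * omega))).
by rewrite -!mulrA omega_sqr !mulrN !mulr1 !opprK.
Qed.

Let B := 'M[C]_2.
Let par2 : B -> B := map_mx (@clf_par _ _ q).

(** The right factor [omega] makes the vector even; carrying it to the left across [clf_rev (psi M)]
    puts the parity on [adjs M]. *)
Lemma psi_conj M v :
  psi M * clf_vec Q v * clf_rev (psi M) * omega =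
  psi (M * vmx v * par2 (adjs M)).
Proof.
rewrite rev_psi psiM psiM psi_vmx -!mulrA omega_psi.
suff -> : map_mx (@clf_par _ _ q) (par2 (adjs M)) = adjs M by [].
by apply: eq_mx2; rewrite !mxE clf_parK.
Qed.

(** Towards a graded representation of Clf(Q): vectors act by off-diagonal blocks, hence even
    elements by block diagonal matrices. It serves to show that [psi] is injective. *)
Let phi_vec v : 'M[B]_2 := mx2 0 (vmx v) (- par2 (vmx v)) 0.

Let vmxB : zmod_morphism vmx.
Proof.
move=> v w; have xiB : xi_of (v - w) = xi_of v - xi_of w.
  rewrite /xi_of !raddfB /= !mxE !raddfB /= ?opprK.
  by rewrite [LHS](AC (2*2) (1*3*(2*4))).
rewrite /vmx /vahlen_vec mx2N mx2D xiB clf_conjD clf_conjN.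
by congr mx2; rewrite ?raddfB ?mxE ?raddfB //= ?opprD.
Qed.

Let vmxZ r v : vmx (r *: v) = mx2 (clf_scal q r) 0 0 (clf_scal q r) * vmx v.
Proof.
have lZ i : lsubmx (r *: v) 0 i = r * lsubmx v 0 i by rewrite !mxE.
have rZ : rsubmx (r *: v) = r *: rsubmx v by exact: linearZ.
have xiZ : xi_of (r *: v) = clf_scal q r * xi_of v.
  by rewrite /xi_of lZ rZ clf_vecZ clf_scalM mulrBr mulrN -[r *: _]clf_scalE.
rewrite /vmx /vahlen_vec mx2M xiZ !lZ !clf_scalM.
by rewrite !(mul0r, addr0, add0r) clf_conjM clf_conj_scal mulrN
  -(clf_scalC r (clf_conj _)).
Qed.

Let par2_mx2 a b c d : par2 (mx2 a b c d) =
  mx2 (clf_par a) (clf_par b) (clf_par c) (clf_par d).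
Proof. exact: map_mx2. Qed.

Let phi_vecB : zmod_morphism phi_vec.
Proof.
move=> v w; rewrite /phi_vec vmxB (mx2N 0) (mx2D 0) oppr0 addr0 /par2 raddfB.
by rewrite !opprD !opprK.
Qed.
HB.instance Definition _ := GRing.isZmodMorphism.Build 'rV[R]_(3 + n) 'M[B]_2
  phi_vec phi_vecB.

Let phi_scal_fun r : 'M[B]_2 := ((clf_scal q r)%:M)%:M.
Let phi_scalB : zmod_morphism phi_scal_fun.
Proof. by move=> r t; rewrite /phi_scal_fun !raddfB. Qed.
Let phi_scalM : monoid_morphism phi_scal_fun.
Proof. by split=> [|r t]; rewrite /phi_scal_fun ?rmorph1 // !rmorphM. Qed.
HB.instance Definition _ := GRing.isZmodMorphism.Build R 'M[B]_2
  phi_scal_fun phi_scalB.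
HB.instance Definition _ := GRing.isMonoidMorphism.Build R 'M[B]_2
  phi_scal_fun phi_scalM.

Let scal2C r (M : B) : (clf_scal q r)%:M * M = M * (clf_scal q r)%:M.
Proof.
rewrite [M]mx2_eta mx2_scalar !mx2M !(mul0r, mulr0, addr0, add0r).
by rewrite !clf_scalC.
Qed.

(** The relation to check is that [vmx v] and [par2 (vmx v)] multiply, in both orders, to the scalar
    matrix [Q v]. *)
Lemma phi_exists : exists F : {rmorphism D -> 'M[B]_2},
  (forall r, F (clf_scal Q r) = phi_scal_fun r) /\
  (forall v, F (clf_vec Q v) = phi_vec v).
Proof.
apply: clf_universal => [r a|r v|v] /=.
- rewrite [a]mx2_eta /phi_scal_fun mx2_scalar !mx2M !(mul0r, mulr0, addr0, add0r).
  by rewrite !scal2C.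
- rewrite /phi_vec /phi_scal_fun mx2_scalar !mx2M !(mul0r, mulr0, addr0, add0r).
  rewrite vmxZ mx2_scalar mulrN; congr (mx2 _ _ (- _) _).
  by rewrite /par2 map_mxM (map_mx2 _ _ 0) /= clf_par_scal raddf0.
- have vE : Q v = lsubmx v 0 0 ^+ 2 + lsubmx v 0 1 * lsubmx v 0 2 + q (rsubmx v).
    by rewrite -[v in LHS]hsubmxK QE.
  rewrite /phi_vec mx2M !(mul0r, mulr0, addr0, add0r) mulrN mulNr.
  rewrite /phi_scal_fun mx2_scalar mx2N oppr0.
  rewrite mx2_scalar /vmx /vahlen_vec conj_xi par2_mx2.
  rewrite /xi_of !clf_parD !clf_parN !clf_par_scal clf_par_vec opprK.
  rewrite !mx2M vE; set x := lsubmx v 0 0; set w := clf_vec q _.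
  have wC r : w * clf_scal q r = clf_scal q r * w by rewrite clf_scalC.
  have ww : w * w = - clf_scal q (q (rsubmx v)) by apply: clf_vec_sqr.
  (* The diagonal entries: the norm of [x + w] is [x ^+ 2] plus the value of [q], in either
     order. *)
  have N1 : (clf_scal q x - w) * (clf_scal q x + w) =
      clf_scal q (x ^+ 2) + clf_scal q (q (rsubmx v)).
    rewrite mulrBl !mulrDr ww wC -clf_scalM -expr2 opprD opprK.
    by rewrite addrA addrK.
  have N2 : (clf_scal q x + w) * (clf_scal q x - w) =
      clf_scal q (x ^+ 2) + clf_scal q (q (rsubmx v)).
    rewrite mulrDl !mulrBr ww wC -clf_scalM -expr2 opprK.
    by rewrite addrA subrK.
  have -> : - clf_scal q x - w = - (clf_scal q x + w) by rewrite opprD.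
  have -> : - clf_scal q x + w = - (clf_scal q x - w) by rewrite opprB addrC.
  have off1 r a : - a * clf_scal q r + clf_scal q r * a = 0.
    by rewrite clf_scalC mulNr addNr.
  have off2 r a : clf_scal q r * - a + a * clf_scal q r = 0.
    by rewrite clf_scalC mulNr addNr.
  rewrite !mulrNN N1 N2 !off1 !off2 -!clf_scalM [lsubmx v 0 2 * _]mulrC.
  by rewrite -!clf_scalD addrAC [lsubmx v 0 1 * _ + _]addrCA addrA.
Qed.

Let simp := (@mulr0, @mul0r, @mulr1, @mul1r, @addr0, @add0r,
  @mulrN, @mulNr, @oppr0, @sub0r, @opprK).

Let vmx_row u w : vmx (row_mx u w) =
  vahlen_vec (- clf_scal q (u 0 0) - clf_vec q w) (u 0 1) (u 0 2).
Proof. by rewrite /vmx /xi_of row_mxKl row_mxKr. Qed.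

Let conjB (r : R) w : clf_conj (- clf_scal q r - clf_vec q w) =
  - clf_scal q r + clf_vec q w.
Proof. by rewrite clf_conjD !clf_conjN clf_conj_scal clf_conj_vec opprK. Qed.

(** Under the block representation [e12] and [e21] become the matrix units in both blocks, and
    [kmor a] becomes [a] in the first block and its parity image in the second. The first block thus
    recovers [M]. *)
Lemma psi_retract : exists F : {rmorphism D -> 'M[B]_2},
  forall M, F (psi M) = mx2 M 0 0 (par2 M).
Proof.
have [F [Fs Fv]] := phi_exists; exists F.
have Fvec u w : F (clf_vec Q (row_mx u w)) =
  mx2 0 (vahlen_vec (- clf_scal q (u 0 0) - clf_vec q w) (u 0 1) (u 0 2))
      (- mx2 (- clf_scal q (u 0 0) + clf_vec q w) (clf_scal q (u 0 1))
         (clf_scal q (u 0 2)) (clf_scal q (u 0 0) + clf_vec q w)) 0.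
  rewrite Fv /phi_vec vmx_row /vahlen_vec par2_mx2 conjB !clf_par_scal.
  by rewrite opprD opprK !clf_parD !clf_parN !clf_par_scal !clf_par_vec !opprK.
have Fx : F ex = mx2 0 (mx2 (-1) 0 0 1) (mx2 1 0 0 (-1)) 0.
  rewrite Fvec /vahlen_vec conjB !mxE /= !clf_scal1 !clf_scal0 !clf_vec0.
  by rewrite mx2N !simp.
have Fy : F ey = mx2 0 (mx2 0 1 0 0) (mx2 0 (-1) 0 0) 0.
  rewrite Fvec /vahlen_vec conjB !mxE /= !clf_scal1 !clf_scal0 !clf_vec0.
  by rewrite mx2N !simp.
have Fz : F ez = mx2 0 (mx2 0 0 1 0) (mx2 0 0 (-1) 0) 0.
  rewrite Fvec /vahlen_vec conjB !mxE /= !clf_scal1 !clf_scal0 !clf_vec0.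
  by rewrite mx2N !simp.
have Fincl w : F (vec_incl w) = mx2 0 (- (clf_vec q w)%:M) (- (clf_vec q w)%:M) 0.
  rewrite Fvec /vahlen_vec conjB !mxE /= !clf_scal0 mx2_scalar.
  by rewrite !mx2N !simp.
have F12 : F e12 = mx2 (mx2 0 1 0 0) 0 0 (mx2 0 1 0 0).
  by rewrite e12E rmorphM /= Fx Fy !(mx2M, simp).
have F21 : F e21 = mx2 (mx2 0 0 1 0) 0 0 (mx2 0 0 1 0).
  by rewrite e21E rmorphN rmorphM /= Fx Fz !(mx2M, mx2N, simp).
have F11 : F (e12 * e21) = mx2 (mx2 1 0 0 0) 0 0 (mx2 1 0 0 0).
  by rewrite rmorphM /= F12 F21 !(mx2M, simp).
have F22 : F (e21 * e12) = mx2 (mx2 0 0 0 1) 0 0 (mx2 0 0 0 1).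
  by rewrite rmorphM /= F12 F21 !(mx2M, simp).
have Fomega : F omega = mx2 0 (- 1%:M) 1%:M 0.
  rewrite omegaE rmorphM rmorphB /= F11 F22 Fx mx2_scalar.
  by rewrite !(mx2N, mx2D, mx2M, simp).
have Fk a : F (kmor a) = mx2 a%:M 0 0 (clf_par a)%:M.
  elim/clf_ind: a => [r|w|x y xP yP|x y xP yP].
  - by rewrite kmor_scal Fs clf_par_scal /phi_scal_fun mx2_scalar.
  - rewrite kmor_vec rmorphM /= Fomega Fincl clf_par_vec mx2M !simp.
    by rewrite raddfN.
  - by rewrite clf_parD !rmorphD /= xP yP mx2D !simp.
  - by rewrite clf_parM !rmorphM /= xP yP mx2M !simp.
have FM x y : F (x * y) = F x * F y by apply: rmorphM.
move=> M; rewrite /psi /mxunits !rmorphD /= !(FM (kmor _)) F11 F22 F12 F21 !Fk.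
rewrite !mx2_scalar !(mx2M, mx2D, simp) /par2.
by congr mx2; rewrite [RHS]mx2_eta // !mxE.
Qed.

Lemma psi_inj : injective psi.
Proof.
have [F FK] := psi_retract.
move=> M N /(congr1 F); rewrite !FK => /(congr1 (fun M : 'M[B]_2 => M 0 0)).
by rewrite !mx2E.
Qed.

Lemma psi_even M : is_even (psi M).
Proof.
have s_even : is_even s.
  rewrite /s e11E e22E; apply: is_evenD; rewrite ?opprK; first apply: is_evenN;
  exact: is_even_vec2.
have k_even a : is_even (kmor a).
  elim/clf_ind: a => [r|w|x y xP yP|x y xP yP].
  - by rewrite kmor_scal; apply: is_even_scal.
  - rewrite kmor_vec -[omega * _]opprK -vec_incl_omega omegaE -/s mulrA.
    by apply/is_evenN/is_evenM/s_even/is_even_vec2.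
  - by rewrite rmorphD; apply: is_evenD.
  - by rewrite rmorphM; apply: is_evenM.
have even12 : is_even e12 by rewrite e12E; apply: is_even_vec2.
have even21 : is_even e21 by rewrite e21E; apply/is_evenN/is_even_vec2.
by rewrite /psi /mxunits; do ![apply: is_evenD | apply: is_evenM].
Qed.

Lemma psi_surj x : is_even x -> exists M, x = psi M.
Proof.
elim/is_even_ind: x / => [r|a b|x y [M ->] [N ->]|x y [M ->] [N ->]].
- by exists (mx2 (clf_scal q r) 0 0 (clf_scal q r)); rewrite psi_scal.
(* Moving [omega] across the second factor gives [psi (vmx a * par2 (vmx b)) * omega] =
   [psi (vmx a) * omega * psi (vmx b)], in which [omega * omega = -1] appears between the two
   vectors; hence the sign. *)
- exists (- (vmx a * par2 (vmx b))).
  have psiN K : psi (- K) = - psi K.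
    by apply/eqP; rewrite -addr_eq0 -psiD addNr /psi /mxunits !mxE !rmorph0 !simp.
  apply: omegaI; rewrite psiN psiM mulNr -(mulrA (psi _)) -omega_psi !psi_vmx.
  by rewrite !mulrA -(mulrA _ omega omega) omega_sqr mulrN1 !mulNr opprK.
- by exists (M + N); rewrite psiD.
- by exists (M * N); rewrite psiM.
Qed.

Definition is_vahlen (Y : B) : Prop :=
  [/\ is_clfvec (Y 0 0), is_scalar (Y 0 1), is_scalar (Y 1 0) &
      Y 1 1 = - clf_conj (Y 0 0)].

Lemma is_vahlenP Y : is_vahlen Y <-> exists v, Y = vmx v.
Proof.
split=> [[[r [w Y00]] [y Y01] [z Y10] Y11]|[v ->]].
  pose u : 'rV[R]_3 := - r *: delta_mx 0 0 + y *: delta_mx 0 1 + z *: delta_mx 0 2.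
  exists (row_mx u (- w)).
  have [u0 u1 u2] : [/\ u 0 0 = - r, u 0 1 = y & u 0 2 = z].
    by rewrite /u !mxE /= !simp.
  have E : - clf_scal q (- r) - clf_vec q (- w) = Y 0 0.
    by rewrite clf_scalN clf_vecN !opprK.
  rewrite vmx_row u0 u1 u2 E /vahlen_vec.
  by apply: eq_mx2; rewrite mx2E.
rewrite /vmx /vahlen_vec; split; rewrite !mx2E //.
- exists (- lsubmx v 0 0), (- rsubmx v).
  by rewrite /xi_of clf_scalN clf_vecN.
- by exists (lsubmx v 0 1).
- by exists (lsubmx v 0 2).
Qed.

Section Action.
Variable M : B.
Let a := M 0 0. Let b := M 0 1. Let c := M 1 0. Let d := M 1 1.
Local Notation "x ^~" := (clf_conj x) (at level 2, format "x ^~").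

Lemma par2_adjs : par2 (adjs M) = mx2 d^~ (- b^~) (- c^~) a^~.
Proof. by rewrite /adjs par2_mx2 !clf_parN !clf_par_rev. Qed.

Let act xi y z := M * vahlen_vec xi y z * par2 (adjs M).

Lemma act00 xi y z : act xi y z 0 0 =
  (a * xi * d^~ + b * xi^~ * c^~) + (z *: (b * d^~) - y *: (a * c^~)).
Proof.
rewrite /act par2_adjs !mul2E !mx2E -/a -/b !mulrDl !mulrN !mulNr opprK.
rewrite -!clf_scalC !clf_scalE -!clf_scaleAl.
by rewrite [RHS](AC (2*2) (1*3*(4*2))).
Qed.


Lemma act01 xi y z : act xi y z 0 1 =
  - (a * xi * b^~ + b * xi^~ * a^~) + (y *: (a * a^~) - z *: (b * b^~)).
Proof.
rewrite /act par2_adjs !mul2E !mx2E -/a -/b !mulrDl !mulrN !mulNr.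
rewrite -!clf_scalC !clf_scalE -!clf_scaleAl.
by rewrite opprD [LHS](AC (2*2) (1*4*(3*2))).
Qed.


Lemma act10 xi y z : act xi y z 1 0 =
  (c * xi * d^~ + d * xi^~ * c^~) + (z *: (d * d^~) - y *: (c * c^~)).
Proof.
rewrite /act par2_adjs !mul2E !mx2E -/c -/d !mulrDl !mulrN !mulNr opprK.
rewrite -!clf_scalC !clf_scalE -!clf_scaleAl.
by rewrite [RHS](AC (2*2) (1*3*(4*2))).
Qed.


(** This gives the last clause of [is_vahlen] for free, leaving conditions on three entries. *)
Lemma act11 xi y z : act xi y z 1 1 = - (act xi y z 0 0)^~.
Proof.
rewrite act00 /act par2_adjs !mul2E !mx2E -/c -/d !mulrDl !mulrN !mulNr.
rewrite !clf_conjD !clf_conjN -!clf_scalE !clf_conjM !clf_conj_scal !clf_conjK.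
rewrite -!clf_scalC !clf_scalE -!clf_scaleAl !mulrA.
by rewrite !opprD opprK [LHS](AC (2*2) (4*1*(2*3))).
Qed.

(** The diagonal of [M * adjs M] is the pseudodeterminant and its transpose; the off-diagonal
    entries are the defects of the two symmetry conditions. *)
Lemma adjsP : M * adjs M = 1 <->
  pdet M = 1 /\ (a * clf_rev b = b * clf_rev a /\ c * clf_rev d = d * clf_rev c).
Proof.
have -> : M * adjs M = mx2 (pdet M) (b * clf_rev a - a * clf_rev b)
    (c * clf_rev d - d * clf_rev c) (clf_rev (pdet M)).
  rewrite /pdet; apply: eq_mx2; rewrite mul2E !mx2E ?mulrN //.
    by rewrite addrC.
  by rewrite clf_revD clf_revN !clf_revM !clf_revK addrC.
rewrite mx2_1; split=> [/matrixP E|[-> [-> ->]]].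
  have:= (E 0 0, E 0 1, E 1 0); rewrite !mx2E => -[[-> /eqP ba] /eqP cd].
  by move: ba cd; rewrite !subr_eq0 => /eqP -> /eqP ->.
by rewrite !subrr clf_rev1.
Qed.

(** The entries of the product are additive in [xi], [y] and [z], so stability can be tested with
    one of the three nonzero at a time. *)
Lemma vahlen_stableP : (forall v, is_vahlen (M * vmx v * par2 (adjs M))) <->
  [/\ [/\ is_scalar (a * a^~), is_scalar (b * b^~),
          is_scalar (c * c^~) & is_scalar (d * d^~)],
      is_clfvec (a * c^~) /\ is_clfvec (b * d^~) &
      forall x, is_clfvec x ->
        [/\ is_scalar (a * x * b^~ + b * x^~ * a^~),
            is_scalar (c * x * d^~ + d * x^~ * c^~) &
            is_clfvec (a * x * d^~ + b * x^~ * c^~)]].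
Proof.
split=> [H|[[aa bb cc dd] [ac bd] H] v].
  have {}H xi y z : is_clfvec xi -> is_vahlen (act xi y z).
    move=> xiP; have [|v E] := (is_vahlenP (vahlen_vec xi y z)).1; 
      last by rewrite /act E; apply: H.
    by rewrite /vahlen_vec; split; rewrite ?mx2E //; [exists y | exists z].
  have conj0 : (0 : C)^~ = 0 by rewrite -clf_scal0 clf_conj_scal.
  (* Taking [y = 1] yields the conditions on [a] and [c], taking [z = 1] those on [b] and [d];
     [xi = x] then yields the conditions quantified over [x]. *)
  have [] := H 0 1 0 (is_clfvec0 q); have [] := H 0 0 1 (is_clfvec0 q).
  rewrite !act00 !act01 !act10 conj0 !simp !scale0r !scale1r ?subr0 ?sub0r.
  move=> bd /is_scalarN; rewrite opprK => bb dd _.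
  move=> /is_clfvecN; rewrite opprK => ac aa /is_scalarN; rewrite opprK => cc _.
  split=> // x xP; have [] := H x 0 0 xP.
  rewrite act00 act01 act10 !scale0r !subr0 !addr0.
  by move=> ? /is_scalarN; rewrite opprK.
have xiP : is_clfvec (xi_of v).
  by case: ((is_vahlenP (vmx v)).2 (ex_intro _ v erefl)); rewrite mx2E.
have [ab cd ad] := H _ xiP; rewrite -/(act _ _ _).
split; [rewrite act00 | rewrite act01 | rewrite act10 | exact: act11].
- by apply: is_clfvecD => //; apply/is_clfvecD/is_clfvecN; apply: is_clfvecZ.
- apply: is_scalarD; first exact: is_scalarN.
  by apply/is_scalarD/is_scalarN; apply: is_scalarZ.
- by apply: is_scalarD => //; apply/is_scalarD/is_scalarN; apply: is_scalarZ.
Qed.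

(** Evenness is automatic; by injectivity of [psi], [adjsP] translates the condition
    [a * clf_rev a = 1] and [vahlen_stableP] the stability of vectors. *)
Lemma Spin_psi : Spin (psi M) <-> SL2 M.
Proof.
have revE : psi M * clf_rev (psi M) = 1 <-> M * adjs M = 1.
  by rewrite rev_psi -psiM -psi1; split=> [/psi_inj|->].
have vecE v : is_vector (psi M * clf_vec Q v * clf_rev (psi M)) <->
    is_vahlen (M * vmx v * par2 (adjs M)).
  rewrite is_vahlenP; split=> -[w E]; exists w.
    by apply: psi_inj; rewrite -psi_conj E psi_vmx.
  by apply: omegaI; rewrite psi_conj E psi_vmx.
have stE : (forall v, is_vector (psi M * clf_vec Q v * clf_rev (psi M))) <->
    (forall v, is_vahlen (M * vmx v * par2 (adjs M))).
  by split=> H v; apply/vecE.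
split=> [/SpinP[_ /revE/adjsP[det1 com] /stE/vahlen_stableP[nrm ac_bd act_x]]|].
  split=> //; split=> //; exists 1, 1.
  by rewrite mulr1 clf_scal1.
case=> -[_ com nrm ac_bd act_x] det1; apply/SpinP; split.
- exact: psi_even.
- exact/revE/adjsP.
- exact/stE/vahlen_stableP.
Qed.

End Action.
End SpinMatrix.

(** * Base change *)

Section QformSum.
Variables (R S : comPzRingType) (m n : nat) (f : {rmorphism R -> S}).
Variables (p : qform R m) (q : qform R n).

Let Q := qform_sum p q.

Let delta_l i : delta_mx 0 (lshift n i) = row_mx (delta_mx 0 i) 0 :> 'rV[R]_(m + n).
Proof.
apply/rowP => k; rewrite mxE; case: (split_ordP k) => j ->;
  rewrite ?row_mxEl ?row_mxEr !mxE.
  by rewrite (inj_eq (@lshift_inj _ _)).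
by rewrite eq_rlshift andbF.
Qed.

Let delta_r i : delta_mx 0 (rshift m i) = row_mx 0 (delta_mx 0 i) :> 'rV[R]_(m + n).
Proof.
apply/rowP => k; rewrite mxE; case: (split_ordP k) => j ->;
  rewrite ?row_mxEl ?row_mxEr !mxE.
  by rewrite eq_lrshift andbF.
by rewrite (inj_eq (@rshift_inj _ _)).
Qed.

Let QE u w : Q (row_mx u w) = p u + q w.
Proof. by rewrite /= /qform_sum_fun row_mxKl row_mxKr. Qed.

Let qcoef_l i j : qcoef Q (lshift n i) (lshift n j) = qcoef p i j.
Proof.
rewrite /qcoef (inj_eq (@lshift_inj _ _)) !delta_l /polar add_row_mx !QE.
by rewrite addr0 !qform0 !addr0.
Qed.

Let qcoef_r i j : qcoef Q (rshift m i) (rshift m j) = qcoef q i j.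
Proof.
rewrite /qcoef (inj_eq (@rshift_inj _ _)) !delta_r /polar add_row_mx !QE.
by rewrite addr0 !qform0 !add0r ltn_add2l.
Qed.

Let qcoef_lr i j : qcoef Q (lshift n i) (rshift m j) = 0.
Proof.
rewrite /qcoef eq_lrshift !delta_l !delta_r /polar add_row_mx !QE.
rewrite addr0 add0r !qform0 ifT; first by ring.
by rewrite /= ltn_addr.
Qed.

Let qcoef_rl i j : qcoef Q (rshift m i) (lshift n j) = 0.
Proof.
by rewrite /qcoef eq_rlshift /= ltnNge ltnW // ltn_addr.
Qed.

(** The coefficient matrix of the sum is block diagonal: one mixed block vanishes by orthogonality,
    the other because [qcoef] is upper triangular. *)
Lemma qform_bc_sum u w :
  qform_bc f Q (row_mx u w) = qform_bc f p u + qform_bc f q w.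
Proof.
rewrite /= /qform_bc_fun big_split_ord /=; congr (_ + _); apply: eq_bigr => i _.
  rewrite big_split_ord /= [X in _ + X]big1 ?addr0 => [|j _].
    by apply: eq_bigr => j _; rewrite qcoef_l !row_mxEl.
  by rewrite qcoef_lr rmorph0 mul0r.
rewrite big_split_ord /= [X in X + _]big1 ?add0r => [|j _].
  by apply: eq_bigr => j _; rewrite qcoef_r !row_mxEr.
by rewrite qcoef_rl rmorph0 mul0r.
Qed.

End QformSum.

Lemma qform_bc_xyz (R S : comPzRingType) (f : {rmorphism R -> S}) u :
  qform_bc f (qform_xyz R) u = qform_xyz S u.
Proof.
rewrite /= /qform_bc_fun /qform_xyz_fun !big_ord_recl !big_ord0 /=.
have o1 : lift ord0 ord0 = 1 :> 'I_3 by apply: val_inj.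
have o2 : lift ord0 (lift ord0 ord0) = 2 :> 'I_3 by apply: val_inj.
rewrite o1 o2 /qcoef /= /polar /= /qform_xyz_fun !mxE /=.
do 2!rewrite ?(expr0n, expr1n, mulr0, mul0r, mulr1, mul1r, addr0, add0r,
  subr0, subrr, rmorph0, rmorph1) /=.
rewrite oppr0 rmorph0 !mul0r !addr0 expr2.
have -> : ord0 = 0 :> 'I_3 by apply: val_inj.
by [].
Qed.

(** * Functoriality of the Clifford algebra and of Spin *)

Section Naturality.
Variables (n : nat) (q : qform int n).
Variables (R S : comPzRingType) (f : {rmorphism R -> S}).

Local Notation cm := (clf_over_map (q := q) f).
Local Notation qR := (qform_over q R).
Local Notation qS := (qform_over q S).

Lemma clf_over_mapD : {morph cm : x y / x + y}.
Proof.
move=> x y; have [[s ->] [t ->]] := (clf_piP x, clf_piP y).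
by rewrite -clf_piD !clf_over_map_pi tmapD clf_piD.
Qed.

Lemma clf_over_mapM : {morph cm : x y / x * y}.
Proof.
move=> x y; have [[s ->] [t ->]] := (clf_piP x, clf_piP y).
by rewrite -clf_piM !clf_over_map_pi tmapM clf_piM.
Qed.

Lemma clf_over_map_scal r : cm (clf_scal qR r) = clf_scal qS (f r).
Proof. by rewrite /clf_scal -clf_pi1 -clf_piZ clf_over_map_pi tmapZ tmap1 clf_piZ. Qed.

Lemma clf_over_map_vec v : cm (clf_vec qR v) = clf_vec qS (map_mx f v).
Proof. by rewrite clf_over_map_pi tmap_vec. Qed.

Let cmB : zmod_morphism cm.
Proof. by move=> x y; apply: (addIr (cm y)); rewrite subrK -clf_over_mapD subrK. Qed.
HB.instance Definition _ := GRing.isZmodMorphism.Build (Clf qR) (Clf qS) cm cmB.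

Let cm1 : monoid_morphism cm.
Proof.
split; last exact: clf_over_mapM.
by rewrite -clf_scal1 clf_over_map_scal rmorph1 clf_scal1.
Qed.
HB.instance Definition _ := GRing.isMonoidMorphism.Build (Clf qR) (Clf qS) cm cm1.

Lemma clf_over_map_rev x : cm (clf_rev x) = clf_rev (cm x).
Proof.
elim/clf_ind: x => [r|v|x y xP yP|x y xP yP].
- by rewrite clf_rev_scal clf_over_map_scal clf_rev_scal.
- by rewrite clf_rev_vec clf_over_map_vec clf_rev_vec.
- by rewrite clf_revD !rmorphD /= clf_revD xP yP.
- by rewrite clf_revM !rmorphM /= clf_revM xP yP.
Qed.

Lemma Spin_over_map a : Spin a -> Spin (cm a).
Proof.
move=> /SpinP[ea a1 aV]; apply/SpinP; split.
- elim/is_even_ind: a / ea {a1 aV} => [r|u v|x y xP yP|x y xP yP].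
  + by rewrite clf_over_map_scal; apply: is_even_scal.
  + by rewrite rmorphM /= !clf_over_map_vec; apply: is_even_vec2.
  + by rewrite rmorphD; apply: is_evenD.
  + by rewrite rmorphM; apply: is_evenM.
- by rewrite -clf_over_map_rev -rmorphM a1 rmorph1.
(* A vector over [S] need not come from [R], but the basis vectors do, and linearity reduces the
   claim to them. *)
- move=> v; rewrite [v]row_sum_delta raddf_sum mulr_sumr mulr_suml.
  elim/big_ind: _ => [||i _]; [exact: is_vector0 | exact: is_vectorD |].
  rewrite /= clf_vecZ -clf_scaleAr -clf_scaleAl; apply: is_vectorZ.
  rewrite -(map_delta_mx f) -clf_over_map_vec -clf_over_map_rev -!rmorphM.
  by have [u ->] := aV (delta_mx 0 i); exists (map_mx f u); rewrite /= clf_over_map_vec.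
Qed.

End Naturality.

Lemma clf_over_map_id n (q : qform int n) (R : comPzRingType)
  (x : Clf (qform_over q R)) : clf_over_map (q := q) idfun x = x.
Proof.
have [s ->] := clf_piP x; rewrite clf_over_map_pi; congr clf_pi.
exact: tensor_inj.
Qed.

Lemma clf_over_map_comp n (q : qform int n) (R S T : comPzRingType)
    (f : {rmorphism R -> S}) (g : {rmorphism S -> T}) (x : Clf (qform_over q R)) :
  clf_over_map (q := q) (g \o f) x = clf_over_map (q := q) g (clf_over_map (q := q) f x).
Proof.
have [s ->] := clf_piP x; rewrite !clf_over_map_pi; congr clf_pi.
exact: tensor_inj.
Qed.

(** * The isomorphism of group functors *)

Section Isomorphism.
Variables (n : nat) (q : qform int n).
Let Q : qform int (3 + n) := qform_sum (qform_xyz int) q.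

Lemma qform_over_sum R u w : qform_over Q R (row_mx u w) =
  qform_xyz R u + qform_over q R w.
Proof. by rewrite /qform_over qform_bc_sum qform_bc_xyz. Qed.

Definition spin_iso R : 'M[Clf (qform_over q R)]_2 -> Clf (qform_over Q R) :=
  psi (@qform_over_sum R).

Section Square.
Variables (R S : comPzRingType) (f : {rmorphism R -> S}).

Let map_row (u : 'rV[R]_3) (w : 'rV[R]_n) :
  clf_over_map (q := Q) f (clf_vec _ (row_mx u w)) =
  clf_vec _ (row_mx (map_mx f u) (map_mx f w)).
Proof. by rewrite clf_over_map_vec map_row_mx. Qed.

(** Base change preserves the basis of the ternary form, hence [e12], [e21] and [omega], and
    therefore commutes with [kmor]; [psi] is built from these alone. *)
Lemma spin_iso_natural M :
  spin_iso (map_mx (clf_over_map (q := q) f) M) =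
  clf_over_map (q := Q) f (spin_iso M).
Proof.
have mx : clf_over_map (q := Q) f (ex _) = ex _.
  by rewrite map_row map_delta_mx map_mx0.
have my : clf_over_map (q := Q) f (ey _) = ey _.
  by rewrite map_row map_delta_mx map_mx0.
have mz : clf_over_map (q := Q) f (ez _) = ez _.
  by rewrite map_row map_delta_mx map_mx0.
have mincl w : clf_over_map (q := Q) f (vec_incl _ w) = vec_incl _ (map_mx f w).
  by rewrite map_row map_mx0.
have m12 : clf_over_map (q := Q) f (e12 _) = e12 _.
  by rewrite !e12E rmorphM /= mx my.
have m21 : clf_over_map (q := Q) f (e21 _) = e21 _.
  by rewrite !e21E rmorphN rmorphM /= mx mz.
have momega : clf_over_map (q := Q) f (omega _) = omega _.
  by rewrite !omegaE rmorphM rmorphB !rmorphM /= mx m12 m21.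
have mk a : clf_over_map (q := Q) f (kmor (@qform_over_sum R) a) =
    kmor (@qform_over_sum S) (clf_over_map (q := q) f a).
  elim/clf_ind: a => [r|w|x y xP yP|x y xP yP].
  - by rewrite kmor_scal !clf_over_map_scal kmor_scal.
  - by rewrite kmor_vec rmorphM /= momega mincl clf_over_map_vec kmor_vec.
  - by rewrite !rmorphD /= xP yP.
  - by rewrite !rmorphM /= xP yP.
by rewrite /spin_iso /psi /mxunits !mxE !rmorphD !rmorphM /= m12 m21 !mk.
Qed.

End Square.

Lemma spin_isoP R M : Spin (@spin_iso R M) <-> SL2 M.
Proof. exact: Spin_psi. Qed.

Lemma spin_iso_inj R : injective (@spin_iso R).
Proof. exact: psi_inj. Qed.

Lemma spin_isoM R : {morph @spin_iso R : M N / M * N}.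
Proof. exact: psiM. Qed.

Lemma spin_iso1 R : @spin_iso R 1 = 1.
Proof. exact: psi1. Qed.

Lemma spin_iso_surj R a : Spin a -> exists2 M, SL2 M & @spin_iso R M = a.
Proof.
move=> aP; have [M aE] : exists M, a = @spin_iso R M.
  by apply: psi_surj; case: aP.
by exists M; rewrite // -spin_isoP -aE.
Qed.

(** The group structure is transported from Spin; in particular inverses are pulled back along
    [spin_iso]. *)
Lemma SL2_group R : is_mul_group (@SL2 R n (qform_over q R)).
Proof.
have [S1 SM SV] := @Spin_group R _ (qform_over Q R).
split=> [|M N|M]; rewrite -!spin_isoP ?spin_iso1 ?spin_isoM //; first exact: SM.
move=> /SV[b [bP Mb bM]]; have [N NP NE] := spin_iso_surj bP.
by exists N; split=> //; apply: spin_iso_inj; rewrite spin_isoM spin_iso1 NE.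
Qed.

Lemma Spin_scheme_group m (p : qform int m) : is_group_functor (Spin_scheme p).
Proof.
split=> /=.
- by move=> R; apply: Spin_group.
- by move=> R S f x; apply: Spin_over_map.
- by move=> R S f x y _ _; apply: clf_over_mapM.
- by move=> R x _; apply: clf_over_map_id.
- by move=> R S T f g x _; apply: clf_over_map_comp.
Qed.

(** Stability under base change and multiplicativity follow from those of Spin by naturality and
    injectivity of [spin_iso]; the identity and composition laws hold entrywise. *)
Lemma SL2_scheme_group : is_group_functor (SL2_scheme q).
Proof.
split=> /=.
- exact: SL2_group.
- by move=> R S f M; rewrite -!spin_isoP spin_iso_natural; apply: Spin_over_map.
- by move=> R S f M N _ _; apply: spin_iso_inj; rewrite spin_iso_natural !spin_isoM
    clf_over_mapM -!spin_iso_natural.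
- by move=> R M _; apply/matrixP => i j; rewrite mxE clf_over_map_id.
- by move=> R S T f g M _; apply/matrixP => i j; rewrite !mxE clf_over_map_comp.
Qed.

End Isomorphism.

Theorem mainTheorem1 (n : nat) (q : qform int n) :
  let Q : qform int (3 + n) := qform_sum (qform_xyz int) q in
  is_group_functor (SL2_scheme q) /\
  is_group_functor (Spin_scheme Q) /\
  exists phi : forall R : comPzRingType,
      ambient (SL2_scheme q) R -> ambient (Spin_scheme Q) R,
    group_functor_iso phi.
Proof.
move=> Q; split; first exact: SL2_scheme_group.
split; first exact: Spin_scheme_group.
exists (@spin_iso n q); split=> [R|R M N _ _|R S f M _] /=.
- split=> [M MP|M N _ _|a aP]; first by apply/spin_isoP.
    exact: spin_iso_inj.
  by have [M MP <-] := spin_iso_surj aP; exists M.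
- exact: spin_isoM.
- exact: spin_iso_natural.
Qed.
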